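(* For any $k \geq 0$, \textsc{1-Edge Contraction($\gamma_{t2}$)} is polynomial-time solvable on $(P_3+kP_2)$-free graphs.
   Context: All graphs are finite, simple and connected. A semitotal dominating set of $G$ is a set $D\subseteq V(G)$ such that every vertex outside $D$ has a neighbour in $D$ and every vertex of $D$ is at distance at most two from another vertex of $D$; $\gamma_{t2}(G)$ is its minimum size. $ct_{\gamma_{t2}}(G)$ is the smallest $k$ such that contracting some $k$ edges of $G$ (contracting $uv$ replaces $u,v$ by one vertex adjacent to all neighbours of $u$ or $v$) yields $G'$ with $\gamma_{t2}(G')<\gamma_{t2}(G)$. \textsc{1-Edge Contraction($\gamma_{t2}$)}: given $G$, decide whether $ct_{\gamma_{t2}}(G)\leq 1$. $P_3+kP_2$ is the disjoint union of a path on three vertices and $k$ copies of a single edge. *)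

(* Defs.v *)
From mathcomp Require Import all_boot.
Set Implicit Arguments. Unset Strict Implicit. Unset Printing Implicit Defensive.

(* A graph: finite vertex type with an adjacency relation (simplicity --
   symmetry and irreflexivity -- is imposed where needed). *)
Record sgraph := SGraph { vert :> finType; adj : rel vert }.
Arguments adj : clear implicits.

Definition simple_graph (G : sgraph) :=
  symmetric (adj G) /\ irreflexive (adj G).

Definition connected_graph (G : sgraph) :=
  forall x y : vert G, connect (adj G) x y.

(* dist(u,w) <= 2 for u <> w *)
Definition within2 (G : sgraph) (u w : vert G) : bool :=
  adj G u w || [exists z : vert G, adj G u z && adj G z w].

Definition semitotal_dom (G : sgraph) (D : {set vert G}) : Prop :=
  (forall x : vert G, x \notin D -> exists2 y, y \in D & adj G x y) /\
  (forall u : vert G, u \in D -> exists2 w, w \in D & (w != u) && within2 u w).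

(* gamma_t2(G') < gamma_t2(G): G' has a semitotal dominating set smaller
   than every semitotal dominating set of G (if G' has none, this fails). *)
Definition gt2_lt (G' G : sgraph) : Prop :=
  exists2 D' : {set vert G'}, semitotal_dom D' &
    forall D : {set vert G}, semitotal_dom D -> #|D'| < #|D|.

Definition contraction_of (G H : sgraph) (u v : vert G) : Prop :=
  adj G u v /\
  exists f : vert G -> vert H,
    [/\ (forall a : vert H, exists x, f x = a),
        f u = f v,
        (forall x y, f x = f y -> x = y \/ (x = u /\ y = v) \/ (x = v /\ y = u))
      & (forall a b : vert H, adj H a b =
           (a != b) && [exists x : vert G, exists y : vert G,
                          [&& f x == a, f y == b & adj G x y]])].

Arguments contraction_of : clear implicits.

Inductive contracts : nat -> sgraph -> sgraph -> Prop :=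
| contracts0 G : contracts 0 G G
| contractsS k G H K (u v : vert G) :
    contraction_of G H u v -> contracts k H K -> contracts k.+1 G K.

Definition ct_le1 (G : sgraph) : Prop :=
  exists k, exists G', [/\ k <= 1, contracts k G G' & gt2_lt G' G].

Definition graph_of (n : nat) (e : rel 'I_n) : sgraph := SGraph e.

(* adjacency of P3 + kP2 on vertices 0..2k+2 : path 0-1-2, edges {2i+3,2i+4} *)
Definition p3kp2_nat (a b : nat) : bool :=
  [|| (a == 0) && (b == 1), (a == 1) && (b == 2)
    | [&& 3 <= a, odd a & b == a.+1]].
Definition p3kp2 (k : nat) : rel 'I_(3 + 2 * k) :=
  fun a b => p3kp2_nat a b || p3kp2_nat b a.

Arguments p3kp2 : clear implicits.
Arguments graph_of : clear implicits.
Definition induced_sub (H G : sgraph) : Prop :=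
  exists f : vert H -> vert G, injective f /\ forall a b : vert H, adj G (f a) (f b) = adj H a b.

Definition P3kP2_free (k : nat) (G : sgraph) : Prop :=
  ~ induced_sub (graph_of _ (p3kp2 k)) G.

Inductive instr :=
| IConst (r c : nat)
| IAdd (r a b : nat)
| ISub (r a b : nat)        (* R[r] := R[a] - R[b] (truncated) *)
| ILoad (r a : nat)
| IStore (a r : nat)
| IJz (r l : nat)
| IHalt.

Definition upd (m : nat -> nat) (r v : nat) : nat -> nat :=
  fun x => if x == r then v else m x.

(* run at most [fuel] steps from program counter pc and memory m;
   Some m' if the program halts (IHalt or pc out of range) within fuel steps *)
Fixpoint exec (p : seq instr) (fuel pc : nat) (m : nat -> nat)
  : option (nat -> nat) :=
  match fuel with
  | 0 => None
  | f.+1 =>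
    match nth IHalt p pc with
    | IHalt => Some m
    | IConst r c => exec p f pc.+1 (upd m r c)
    | IAdd r a b => exec p f pc.+1 (upd m r (m a + m b))
    | ISub r a b => exec p f pc.+1 (upd m r (m a - m b))
    | ILoad r a => exec p f pc.+1 (upd m r (m (m a)))
    | IStore a r => exec p f pc.+1 (upd m (m a) (m r))
    | IJz r l => exec p f (if m r == 0 then l else pc.+1) m
    end
  end.

(* input encoding of a graph on 'I_n: R[0] = n, R[1 + i*n + j] = [ij edge],
   all other registers 0 *)
Definition encode (n : nat) (e : rel 'I_n) : nat -> nat :=
  fun x => if x == 0 then n
           else if x <= n * n then
             nat_of_bool [exists i : 'I_n, exists j : 'I_n,
               [&& nat_of_ord i == (x.-1) %/ n, nat_of_ord j == (x.-1) %% n & e i j]]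
           else 0.

Arguments encode : clear implicits.

(* Main.v *)
Require Import Defs.
From mathcomp Require Import all_boot zify.
From Stdlib Require Import Classical.
Set Implicit Arguments. Unset Strict Implicit. Unset Printing Implicit Defensive.

(** One contraction lowers gamma_t2 iff some minimum semitotal dominating set
    contains a friendly triple: x adjacent to y, and z within distance two of y.
    On (P3+kP2)-free graphs this is equivalent to a fixed first-order sentence,
    which a RAM evaluates in polynomial time by nested loops.

    Fix an induced matching of w edges (w a large constant) and call a vertex a
    hub if it touches two of them.  Removing the hubs leaves a disjoint union of
    cliques, and every hub is adjacent to all but at most one vertex of all but
    at most k + 1 of these cliques.  If no r hubs (1 <= r <= 3k + 4) dominate r
    cliques, then no set of hubs dominates as many cliques as it has elements,
    so the minimum sets are exactly hub-free transversals of the cliques: they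
    are independent and no contraction helps.

    Conversely suppose no contraction helps and gamma_t2 is large.  A maximal
    induced P3+jP2 gives a bounded set A such that the vertices C at distance at
    least two from A are independent; covering C from its neighbourhood costs at
    least gamma_t2 - |A|.  Comparing a minimum set D with this bound yields w
    edges of an induced matching each having an end in D, and for this matching
    an exchange argument rules out hubs trading for cliques.  Bounded gamma_t2
    is settled by exhaustive search, again first-order. *)

(** * First-order formulas on a RAM *)

(** Since gamma_t2 is unbounded, no formula can quantify over a minimum set; for large gamma_t2 the
    sentence instead asks for a matching of fixed size as a certificate that no contraction helps.
    The obstacle is that excluding trades of r hubs for r cliques for every r is not first-order.
    The cap r <= 3k + 4 suffices. In a larger trade fix one hub h: at least 2k + 4 of the traded
    cliques have exactly one vertex missed by h. Give each of them a hub of the trade that covers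
    the missed vertex. For two such cliques, these hubs cannot each miss at most one vertex of the
    other's clique, since otherwise two hubs would dominate two cliques. But a hub misses two
    vertices in at most k + 1 cliques, and counting pairs yields 2k + 3 <= 2k + 2. The number w = 8k
    + 20 of matching edges only has to exceed the cliques lost to such exceptions plus the size of a
    trade. *)

Inductive form :=
| FAdj (i j : nat) | FEq (i j : nat) | FNot of form | FAnd of form & form | FEx of form.

Fixpoint eval (G : sgraph) (phi : form) (env : seq G) : bool :=
  match phi with
  | FAdj i j => if (onth env i, onth env j) is (Some x, Some y) then adj G x y else false
  | FEq i j => if (onth env i, onth env j) is (Some x, Some y) then x == y else false
  | FNot f => ~~ eval f env
  | FAnd f g => eval f env && eval g env
  | FEx f => [exists x, eval f (rcons env x)]
  end.

Fixpoint qdepth (phi : form) : nat :=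
  match phi with
  | FAdj _ _ | FEq _ _ => 0
  | FNot f => qdepth f
  | FAnd f g => maxn (qdepth f) (qdepth g)
  | FEx f => (qdepth f).+1
  end.

(* Registers: 1 holds 0, 2 holds n, 3 holds the address of the first matrix
   entry, 4 holds 1, 5 holds the truth value, 6-9 are scratch, and 10 + i holds
   the i-th variable.  A matrix entry is always read below the diagonal. *)
Fixpoint compile (d pc : nat) (phi : form) : seq instr :=
  match phi with
  | FAdj i j =>
    if (i < d) && (j < d) then
      [:: ISub 6 (10 + i) (10 + j); IAdd 7 (10 + j) 6; ISub 8 (10 + i) 6;
          IAdd 9 3 8; IJz 7 (pc + 8); IAdd 9 9 2; ISub 7 7 4; IJz 1 (pc + 4);
          ILoad 5 9]
    else [:: IConst 5 0]
  | FEq i j =>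
    if (i < d) && (j < d) then
      [:: ISub 6 (10 + i) (10 + j); ISub 7 (10 + j) (10 + i); IAdd 6 6 7; ISub 5 4 6]
    else [:: IConst 5 0]
  | FNot f => compile d pc f ++ [:: ISub 5 4 5]
  | FAnd f g =>
    let c := compile d pc f in
    let c' := compile d (pc + size c + 1) g in
    c ++ IJz 5 (pc + size c + 1 + size c') :: c'
  | FEx f =>
    let c := compile d.+1 (pc + 3) f in
    let q := pc + 3 + size c in
    [:: IConst (10 + d) 0; ISub 6 2 (10 + d); IJz 6 (q + 4)] ++ c ++
    [:: IJz 5 (q + 2); IJz 1 (q + 5); IAdd (10 + d) (10 + d) 4; IJz 1 (pc + 1); IConst 5 0]
  end.

Fixpoint time (phi : form) (n : nat) : nat :=
  match phi with
  | FAdj _ _ => 4 * n + 6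
  | FEq _ _ => 4
  | FNot f => time f n + 1
  | FAnd f g => time f n + 1 + time g n
  | FEx f => n * (time f n + 6) + 4
  end.

Lemma time_poly phi : exists c, forall n, time phi n <= c * n.+1 ^ c.
Proof.
elim: phi => [i j|i j|f [c Hc]|f [c Hc] g [c' Hc']|f [c Hc]] /=.
- by exists 6 => n; have := leq_pexp2l (ltn0Sn n) (isT : 1 <= 6); rewrite expn1; lia.
- by exists 4 => n; have := expn_gt0 n.+1 4; lia.
- exists c.+1 => n; have := Hc n; have := leq_pexp2l (ltn0Sn n) (leqnSn c).
  have := expn_gt0 n.+1 c.+1; nia.
- exists (c + c').+1 => n; have := Hc n; have := Hc' n.
  have := leq_pexp2l (ltn0Sn n) (leq_trans (leq_addr c' c) (leqnSn _)).
  have := leq_pexp2l (ltn0Sn n) (leq_trans (leq_addl c c') (leqnSn _)).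
  have := expn_gt0 n.+1 (c + c').+1; nia.
(* The coefficient absorbs 6 per iteration and 4 outside the loop; the exponent only has to exceed
   [c], and one number serves as both. *)
- exists (c + 10) => n; have H := Hc n.
  have h1 : n.+1 ^ c.+1 <= n.+1 ^ (c + 10) by apply: leq_pexp2l => //; lia.
  have h2 : n.+1 ^ 1 <= n.+1 ^ (c + 10) by apply: leq_pexp2l => //; lia.
  have h3 : n * (time f n + 6) <= n.+1 * (c * n.+1 ^ c + 6) by apply: leq_mul; lia.
  have h5 : n.+1 * (c * n.+1 ^ c + 6) = c * (n.+1 * n.+1 ^ c) + n.+1 * 6 by rewrite mulnDr mulnCA.
  move: h1 h2 h3; rewrite expn1 (expnS n.+1 c) h5.
  move: (n.+1 ^ (c + 10)) (n.+1 * n.+1 ^ c) => X Y h1 h2 h3.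
  have h4 : c * Y <= c * X by apply: leq_mul.
  rewrite mulnDl; lia.
Qed.

(** The exact step count is hidden below a bound so that bounds can be weakened, and the remaining
    fuel is universally quantified so that fragments compose by adding bounds. *)
Definition runs (p : seq instr) (t pc : nat) (m : nat -> nat) (pc' : nat) (m' : nat -> nat) :=
  exists2 s, s <= t & forall f, exec p (s + f) pc m = exec p f pc' m'.

Lemma runs0 p pc m : runs p 0 pc m pc m.
Proof. by exists 0. Qed.

Lemma runs_trans p t1 t2 pc1 m1 pc2 m2 pc3 m3 :
  runs p t1 pc1 m1 pc2 m2 -> runs p t2 pc2 m2 pc3 m3 ->
  runs p (t1 + t2) pc1 m1 pc3 m3.
Proof.
move=> [s1 h1 r1] [s2 h2 r2]; exists (s1 + s2); first exact: leq_add.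
by move=> f; rewrite -addnA r1 r2.
Qed.

Lemma runs_le p t t' pc m pc' m' : t <= t' -> runs p t pc m pc' m' -> runs p t' pc m pc' m'.
Proof. by move=> h [s hs r]; exists s => //; apply: leq_trans h. Qed.

(** Jump targets are absolute, so a fragment is described by its position inside the whole program
    rather than run on its own. *)
Definition has_code (p : seq instr) (pc : nat) (c : seq instr) :=
  forall i, i < size c -> nth IHalt p (pc + i) = nth IHalt c i.

Lemma has_code_catl p pc c c' : has_code p pc (c ++ c') -> has_code p pc c.
Proof.
move=> h i hi; rewrite h ?size_cat; last by lia.
by rewrite nth_cat hi.
Qed.

Lemma has_code_catr p pc c c' : has_code p pc (c ++ c') -> has_code p (pc + size c) c'.
Proof.
move=> h i hi; rewrite -addnA h ?size_cat; last by lia.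
by rewrite nth_cat ltnNge leq_addr /= addKn.
Qed.

Definition next_state (i : instr) (pc : nat) (m : nat -> nat) : nat * (nat -> nat) :=
  match i with
  | IHalt => (pc, m)
  | IConst r c => (pc.+1, upd m r c)
  | IAdd r a b => (pc.+1, upd m r (m a + m b))
  | ISub r a b => (pc.+1, upd m r (m a - m b))
  | ILoad r a => (pc.+1, upd m r (m (m a)))
  | IStore a r => (pc.+1, upd m (m a) (m r))
  | IJz r l => (if m r == 0 then l else pc.+1, m)
  end.

Lemma runs_step p t pc m i pc' m' :
  nth IHalt p pc = i -> (if i is IHalt then false else true) ->
  runs p t (next_state i pc m).1 (next_state i pc m).2 pc' m' ->
  runs p t.+1 pc m pc' m'.
Proof.
move=> E hi [s hs r]; exists s.+1 => // f.
by rewrite addSn /= E; move: hi r; case: i {E}.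
Qed.

(** Compiled code uses registers below [L], and [b.+1] is the address of the first matrix entry. The
    exception in [lay_far] is register 1: it may coincide with the diagonal entry (0,0), whose value
    0 is exactly the constant that register 1 holds. Because of [lay1], [IJz 1] is an unconditional
    jump. *)
Record layout (L n : nat) (e : rel 'I_n) (b : nat) (m : nat -> nat) : Prop := Layout {
  lay1 : m 1 = 0; lay2 : m 2 = n; lay3 : m 3 = b.+1; lay4 : m 4 = 1;
  lay_adj : forall i j : 'I_n, i <= j -> m (b.+1 + i + j * n) = e i j;
  lay_far : forall i j : 'I_n, i <= j -> b.+1 + i + j * n = 1 \/ L <= b.+1 + i + j * n }.

Lemma layout_upd L n (e : rel 'I_n) b m r v :
  5 <= r < L -> layout L e b m -> layout L e b (upd m r v).
Proof.
move=> /andP[h5 hL] [h1 h2 h3 h4 ha hf]; split=> //; rewrite /upd.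
- by case: eqP => // E; lia.
- by case: eqP => // E; lia.
- by case: eqP => // E; lia.
- by case: eqP => // E; lia.
- move=> i j hij; case: eqP => [E|_]; last exact: ha.
  by have := hf i j hij; lia.
Qed.

Lemma updE m r v x : upd m r v x = if x == r then v else m x. Proof. by []. Qed.

Definition stores (n d : nat) (env : seq 'I_n) (m : nat -> nat) :=
  forall i, i < d -> omap (@nat_of_ord n) (onth env i) = Some (m (10 + i)).

Section CompileCorrect.
Variables (L n : nat) (e : rel 'I_n) (b : nat) (p : seq instr).
Hypothesis e_sym : symmetric e.

Lemma comp_adj_loop pc m q :
  has_code p pc [:: IJz 7 (pc + 4); IAdd 9 9 2; ISub 7 7 4; IJz 1 pc] ->
  9 < L -> layout L e b m -> m 7 = q ->
  exists m', [/\ runs p (4 * q + 1) pc m (pc + 4) m', layout L e b m',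
    m' 9 = m 9 + q * n & forall x, 9 < x -> m' x = m x].
Proof.
move=> hc hL; elim: q m => [|q IH] m hm hq.
  exists m; split=> //; last by rewrite mul0n addn0.
  apply: (runs_step (i := IJz 7 (pc + 4))) => //; first by have := hc 0 isT; rewrite addn0.
  by rewrite /= hq; apply: runs0.
pose m2 := upd (upd m 9 (m 9 + m 2)) 7 (m 7 - m 4).
have hm2 : layout L e b m2 by do 2![apply: layout_upd; first by lia].
have m27 : m2 7 = q by rewrite /m2 !updE /= hq (lay4 hm) subn1.
have [m' [hr hl h9 hx]] := IH m2 hm2 m27.
exists m'; split=> //.
- apply: (@runs_le _ (4 * q + 1).+4); first by lia.
  apply: (runs_step (i := IJz 7 (pc + 4))) => //; first by have := hc 0 isT; rewrite addn0.
  rewrite /= hq /= -[pc.+1]addn1.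
  apply: (runs_step (i := IAdd 9 9 2)) => //; first exact: hc 1 isT.
  rewrite /= -[(pc + 1).+1]addn1 -addnA.
  apply: (runs_step (i := ISub 7 7 4)) => //; first exact: hc 2 isT.
  rewrite /= -[(pc + _).+1]addn1 -addnA.
  apply: (runs_step (i := IJz 1 pc)) => //; first exact: hc 3 isT.
  rewrite /= (_ : upd _ 9 _ 7 = m 7) // (_ : upd _ 9 _ 4 = m 4) //.
  by rewrite -/m2 (lay1 hm2).
- by rewrite h9 /m2 !updE /= (lay2 hm) mulSn addnA.
- move=> x hx9; rewrite hx // /m2 !updE; case: eqP => [|_]; first by lia.
  by case: eqP => //; lia.
Qed.

Lemma comp_adj_correct i j d pc (env : seq 'I_n) m :
  i < d -> j < d -> size env = d -> 10 + d <= L ->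
  has_code p pc (compile d pc (FAdj i j)) -> layout L e b m -> stores d env m ->
  exists m', [/\ runs p (4 * n + 6) pc m (pc + 9) m', layout L e b m',
    m' 5 = eval (G := graph_of n e) (FAdj i j) env & forall x, 9 < x -> m' x = m x].
Proof.
move=> hi hj hsz hL /=; rewrite hi hj /= => hc hm hst.
have := hst i hi; have := hst j hj.
case: (onth env i) => [x|//]; case: (onth env j) => [y|//] [Ey] [Ex].
(* Truncated subtraction yields the maximum [y + (x - y)] and the minimum [x - (x - y)]; the loop
   then multiplies the maximum by [n] through repeated addition. *)
pose m1 := upd m 6 (x - y).
pose m2 := upd m1 7 (y + (x - y)).
pose m3 := upd m2 8 (x - (x - y)).
pose m4 := upd m3 9 (b.+1 + (x - (x - y))).
have hm4 : layout L e b m4.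
  by do 4![apply: layout_upd; first by lia].
have hc4 : has_code p (pc + 4) [:: IJz 7 (pc + 4 + 4); IAdd 9 9 2; ISub 7 7 4; IJz 1 (pc + 4)].
  by rewrite -addnA => -[|[|[|[|//]]]] _; rewrite -addnA hc.
have m47 : m4 7 = y + (x - y) by [].
have hL9 : 9 < L by lia.
have [m5 [hr5 hl5 h59 h5x]] := comp_adj_loop hc4 hL9 hm4 m47.
exists (upd m5 5 (m5 (m5 9))); split.
- have hx := ltn_ord x; have hy := ltn_ord y.
  apply: (@runs_le _ (4 + ((4 * (y + (x - y)) + 1) + 1))).
    by move: hx hy; move: (nat_of_ord x) (nat_of_ord y) => *; lia.
  apply: (@runs_trans _ _ _ _ _ (pc + 4) m4).
    apply: (runs_step (i := ISub 6 (10 + i) (10 + j))) => //; first by have := hc 0 isT; rewrite addn0.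
    rewrite /= -Ex -Ey -[pc.+1]addn1.
    apply: (runs_step (i := IAdd 7 (10 + j) 6)) => //; first exact: hc 1 isT.
    rewrite /= !updE /= -Ey -[(pc + 1).+1]addn1 -addnA.
    apply: (runs_step (i := ISub 8 (10 + i) 6)) => //; first exact: hc 2 isT.
    rewrite /= !updE /= -Ex -[(pc + _).+1]addn1 -addnA.
    apply: (runs_step (i := IAdd 9 3 8)) => //; first exact: hc 3 isT.
    rewrite /= !updE /= (lay3 hm) -[(pc + _).+1]addn1 -addnA.
    exact: runs0.
  apply: runs_trans hr5 _; rewrite -addnA.
  apply: (runs_step (i := ILoad 5 9)) => //; first exact: hc 8 isT.
  by rewrite /= -addnS; apply: runs0.
- by apply: layout_upd => //; lia.
- rewrite updE /= h59 (_ : m4 9 = b.+1 + (x - (x - y))) //.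
  case: (leqP x y) => hxy.
    have E1 : (x : nat) - (x - y) = x by rewrite (eqP hxy) subn0.
    have E2 : (y : nat) + (x - y) = y by rewrite (eqP hxy) addn0.
    by rewrite E1 E2; apply: (lay_adj hl5).
  have E1 : (x : nat) - (x - y) = y by rewrite subKn // ltnW.
  have E2 : (y : nat) + (x - y) = x by rewrite subnKC // ltnW.
  by rewrite E1 E2 e_sym; apply: (lay_adj hl5); apply: ltnW.
- move=> z hz; rewrite updE; case: eqP => [|_]; first by lia.
  rewrite h5x // /m4 /m3 /m2 /m1 !updE.
  by do !(case: eqP => [|_]; first by lia).
Qed.

Lemma comp_eq_correct i j d pc (env : seq 'I_n) m :
  i < d -> j < d -> size env = d -> 10 + d <= L ->
  has_code p pc (compile d pc (FEq i j)) -> layout L e b m -> stores d env m ->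
  exists m', [/\ runs p 4 pc m (pc + 4) m', layout L e b m',
    m' 5 = eval (G := graph_of n e) (FEq i j) env & forall x, 9 < x -> m' x = m x].
Proof.
move=> hi hj hsz hL /=; rewrite hi hj /= => hc hm hst.
have := hst i hi; have := hst j hj.
case: (onth env i) => [x|//]; case: (onth env j) => [y|//] [Ey] [Ex].
pose m1 := upd m 6 (x - y).
pose m2 := upd m1 7 (y - x).
pose m3 := upd m2 6 (x - y + (y - x)).
exists (upd m3 5 (1 - (x - y + (y - x)))); split.
- apply: (runs_step (i := ISub 6 (10 + i) (10 + j))) => //; first by have := hc 0 isT; rewrite addn0.
  rewrite /= -Ex -Ey -[pc.+1]addn1.
  apply: (runs_step (i := ISub 7 (10 + j) (10 + i))) => //; first exact: hc 1 isT.
  rewrite /= !updE /= -Ex -Ey -[(pc + 1).+1]addn1 -addnA.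
  apply: (runs_step (i := IAdd 6 6 7)) => //; first exact: hc 2 isT.
  rewrite /= !updE /= -[(pc + _).+1]addn1 -addnA.
  apply: (runs_step (i := ISub 5 4 6)) => //; first exact: hc 3 isT.
  rewrite /= !updE /= (lay4 hm) -[(pc + _).+1]addn1 -addnA.
  exact: runs0.
- by do 4![apply: layout_upd; first by lia].
- rewrite updE /=; case: (x =P y) => [->|ne]; first by rewrite subnn.
  by have : (x : nat) <> y by [move=> E; apply: ne; apply: val_inj]; rewrite /=; lia.
- move=> z hz; rewrite /m3 /m2 /m1 !updE.
  by do !(case: eqP => [|_]; first by lia).
Qed.

Lemma comp_false d pc m :
  has_code p pc [:: IConst 5 0] -> 10 + d <= L -> layout L e b m ->
  exists m', [/\ runs p 1 pc m (pc + 1) m', layout L e b m', m' 5 = 0 &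
    forall x, 9 < x -> m' x = m x].
Proof.
move=> hc hL hm; exists (upd m 5 0); split=> //.
- apply: (runs_step (i := IConst 5 0)) => //; first by have := hc 0 isT; rewrite addn0.
  by rewrite /= addn1; apply: runs0.
- by apply: layout_upd => //; lia.
- by move=> x hx; rewrite updE; case: eqP => //; lia.
Qed.

Lemma onth_oob (T : Type) (s : seq T) i : size s <= i -> onth s i = None.
Proof. by elim: s i => [|x s IH] [|i] //=; apply: IH. Qed.

Lemma onth_rcons (T : Type) (s : seq T) x i :
  onth (rcons s x) i = if i < size s then onth s i else if i == size s then Some x else None.
Proof.
by elim: s i => [|y s IH] [|i] //=; case: i.
Qed.

(** Inner quantifiers overwrite registers from [10 + d] on, so only the registers of the [d]
    variables in scope are promised unchanged. The bound on [L] reserves one register per nested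
    quantifier. *)
Lemma comp_correct phi d pc (env : seq 'I_n) m :
  size env = d -> 10 + d + qdepth phi <= L ->
  has_code p pc (compile d pc phi) -> layout L e b m -> stores d env m ->
  exists m', [/\ runs p (time phi n) pc m (pc + size (compile d pc phi)) m',
    layout L e b m', m' 5 = eval (G := graph_of n e) phi env
    & forall x, 9 < x < 10 + d -> m' x = m x].
Proof.
elim: phi d pc env m => [i j|i j|f IH|f IHf g IHg|f IH] d pc env m hsz hL hc hm hst.
- case: (boolP ((i < d) && (j < d))) => hij.
    have /andP[hi hj] := hij.
    have hL' : 10 + d <= L by move: hL => /=; lia.
    have [m' [h1 h2 h3 h4]] := comp_adj_correct hi hj hsz hL' hc hm hst.
    exists m'; split=> //; first by rewrite /= hij.
    by move=> x /andP[hx _]; apply: h4.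
  have hc' : has_code p pc [:: IConst 5 0] by move: hc; rewrite /= (negbTE hij).
  have [m' [h1 h2 h3 h4]] := comp_false (d := d) hc' ltac:(move: hL => /=; lia) hm.
  exists m'; split=> //.
  + by rewrite /= (negbTE hij) /=; apply: runs_le h1; lia.
  + rewrite h3 /=; move: hij; rewrite negb_and -!leqNgt -hsz.
    case/orP=> /onth_oob -> //; by case: (onth env i).
  + by move=> x /andP[hx _]; apply: h4.
- case: (boolP ((i < d) && (j < d))) => hij.
    have /andP[hi hj] := hij.
    have hL' : 10 + d <= L by move: hL => /=; lia.
    have [m' [h1 h2 h3 h4]] := comp_eq_correct hi hj hsz hL' hc hm hst.
    exists m'; split=> //; first by rewrite /= hij.
    by move=> x /andP[hx _]; apply: h4.
  have hc' : has_code p pc [:: IConst 5 0] by move: hc; rewrite /= (negbTE hij).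
  have [m' [h1 h2 h3 h4]] := comp_false (d := d) hc' ltac:(move: hL => /=; lia) hm.
  exists m'; split=> //.
  + by rewrite /= (negbTE hij) /=; apply: runs_le h1; lia.
  + rewrite h3 /=; move: hij; rewrite negb_and -!leqNgt -hsz.
    case/orP=> /onth_oob -> //; by case: (onth env i).
  + by move=> x /andP[hx _]; apply: h4.
- have [m' [h1 h2 h3 h4]] := IH d pc env m hsz hL (has_code_catl hc) hm hst.
  exists (upd m' 5 (1 - m' 5)); split.
  + rewrite /= size_cat addnA.
    apply: runs_trans h1 _; apply: (runs_step (i := ISub 5 4 5)) => //.
      by have := has_code_catr hc (isT : 0 < 1); rewrite addn0.
    by rewrite /= (lay4 h2) addn1; apply: runs0.
  + by apply: layout_upd => //; move: hL => /=; lia.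
  + by rewrite updE /= h3; case: (eval _ _).
  + by move=> x hx; rewrite updE; case: eqP => [|_]; [lia|apply: h4].
- have hLf : 10 + d + qdepth f <= L by move: hL => /=; lia.
  have hLg : 10 + d + qdepth g <= L by move: hL => /=; lia.
  rewrite /= in hc *.
  set c := compile d pc f in hc *; set c' := compile d (pc + size c + 1) g in hc *.
  have hcf : has_code p pc c by exact: has_code_catl hc.
  have hcr : has_code p (pc + size c) (IJz 5 (pc + size c + 1 + size c') :: c') by exact: has_code_catr hc.
  have hcg : has_code p (pc + size c + 1) c'.
    by apply: (@has_code_catr p _ [:: IJz 5 (pc + size c + 1 + size c')]).
  have [m1 [h1 h2 h3 h4]] := IHf d pc env m hsz hLf hcf hm hst.
  have hst1 : stores d env m1 by move=> i hi; rewrite hst // h4 //; lia.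
  have j0 : nth IHalt p (pc + size c) = IJz 5 (pc + size c + 1 + size c').
    by have := hcr 0 isT; rewrite addn0.
  have Esz : pc + size (c ++ IJz 5 (pc + size c + 1 + size c') :: c') = pc + size c + 1 + size c'.
    by rewrite size_cat /=; lia.
  rewrite Esz.
  case E: (eval (G := graph_of n e) f env) h3 => h3.
    have [m2 [g1 g2 g3 g4]] := IHg d _ env m1 hsz hLg hcg h2 hst1.
    exists m2; split=> //; last by move=> x hx; rewrite g4 // h4.
    rewrite -addnA; apply: runs_trans h1 _; rewrite add1n; apply: (runs_step j0) => //.
    by rewrite /= h3 /= -[(pc + size c).+1]addn1.
  exists m1; split=> //.
  rewrite -addnA; apply: runs_trans h1 _; rewrite add1n; apply: (runs_step j0) => //.
  by rewrite /= h3; apply: runs_le (runs0 _ _ _).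
- have hLf : 10 + d.+1 + qdepth f <= L by move: hL => /=; lia.
  rewrite /= in hc *.
  set c := compile d.+1 (pc + 3) f in hc *.
  pose q := pc + 3 + size c; rewrite -/q in hc *.
  have c0 : nth IHalt p pc = IConst (10 + d) 0 by have := hc 0 isT; rewrite addn0.
  have c1 : nth IHalt p (pc + 1) = ISub 6 2 (10 + d) by exact: hc 1 isT.
  have c2 : nth IHalt p (pc + 2) = IJz 6 (q + 4) by exact: hc 2 isT.
  have hc3 : has_code p (pc + 3) (c ++ [:: IJz 5 (q + 2); IJz 1 (q + 5);
      IAdd (10 + d) (10 + d) 4; IJz 1 (pc + 1); IConst 5 0]).
    by apply: (@has_code_catr p pc [:: IConst (10 + d) 0; ISub 6 2 (10 + d); IJz 6 (q + 4)]).
  have hcf := has_code_catl hc3.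
  have := has_code_catr hc3; rewrite -/q => hc4.
  have q0 : nth IHalt p q = IJz 5 (q + 2) by have := hc4 0 isT; rewrite addn0.
  have q1 : nth IHalt p (q + 1) = IJz 1 (q + 5) by exact: hc4 1 isT.
  have q2 : nth IHalt p (q + 2) = IAdd (10 + d) (10 + d) 4 by exact: hc4 2 isT.
  have q3 : nth IHalt p (q + 3) = IJz 1 (pc + 1) by exact: hc4 3 isT.
  have q4 : nth IHalt p (q + 4) = IConst 5 0 by exact: hc4 4 isT.
  have Esz : pc + (size (c ++ [:: IJz 5 (q + 2); IJz 1 (q + 5);
      IAdd (10 + d) (10 + d) 4; IJz 1 (pc + 1); IConst 5 0])).+3 = q + 5.
    by rewrite size_cat /= /q; lia.
  rewrite Esz.
  (* [r] counts the candidates still to be tried, so the loop decides the existential over values at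
     least [n - r]. *)
  have loop : forall r m0, layout L e b m0 -> stores d env m0 -> r <= n -> m0 (10 + d) = n - r ->
     exists m', [/\ runs p (r * (time f n + 6) + 3) (pc + 1) m0 (q + 5) m', layout L e b m',
       m' 5 = [exists x : 'I_n, (n - r <= x) && eval (G := graph_of n e) f (rcons env x)]
       & forall x, 9 < x < 10 + d -> m' x = m0 x].
    elim=> [|r IHr] m0 hm0 hst0 hr hx.
      pose m1 := upd m0 6 0.
      have hm1 : layout L e b m1 by apply: layout_upd => //; lia.
      exists (upd m1 5 0); split.
      + apply: (runs_step c1) => //=; rewrite (lay2 hm0) hx subn0 subnn -/m1.
        rewrite -[(pc + 1).+1]addn1 -addnA.
        apply: (runs_step c2) => //=; apply: (runs_step q4) => //=.
        by rewrite -addnS; apply: runs0.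
      + by apply: layout_upd => //; lia.
      + rewrite updE /=; symmetry; apply/eqP; rewrite eqb0; apply/existsPn => x.
        by rewrite subn0 negb_and -ltnNge ltn_ord.
      + by move=> x hx'; rewrite /m1 !updE; do !(case: eqP => [|_]; first by lia).
    pose m1 := upd m0 6 r.+1.
    have hm1 : layout L e b m1 by apply: layout_upd => //; lia.
    have hlt : n - r.+1 < n by lia.
    pose x0 : 'I_n := Ordinal hlt.
    have hst1 : stores d.+1 (rcons env x0) m1.
      move=> i; rewrite ltnS leq_eqVlt onth_rcons hsz => /orP[/eqP->|hi].
        by rewrite ltnn eqxx /m1 updE; case: eqP => [|_]; [lia|rewrite hx].
      by rewrite hi hst0 // /m1 updE; case: eqP => //; lia.
    have hsz1 : size (rcons env x0) = d.+1 by rewrite size_rcons hsz.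
    have [m2 [g1 g2 g3 g4]] := IH d.+1 (pc + 3) (rcons env x0) m1 hsz1 hLf hcf hm1 hst1.
    rewrite -/c -/q in g1.
    have R2 : runs p (2 + time f n) (pc + 1) m0 q m2.
      rewrite -[2]/(0.+2) !addSn add0n.
      apply: (runs_step c1) => //=; rewrite (lay2 hm0) hx subKn // -/m1.
      rewrite -[(pc + 1).+1]addn1 -addnA.
      by apply: (runs_step c2) => //=; rewrite -[(pc + (1 + 1)).+1]addn1 -addnA.
    have frame2 x : 9 < x < 10 + d -> m2 x = m0 x.
      by move=> hx'; rewrite g4 /m1 ?updE; [case: eqP => // ?; lia|lia].
    case E: (eval (G := graph_of n e) f (rcons env x0)) g3 => g3.
      exists m2; split=> //.
      + apply: (@runs_le _ (2 + time f n + 2)); first by nia.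
        apply: runs_trans R2 _; apply: (runs_step q0) => //=; rewrite g3 /= -[q.+1]addn1.
        by apply: (runs_step q1) => //=; rewrite (lay1 g2); apply: runs0.
      + rewrite g3; symmetry; apply/eqP; rewrite eqb1; apply/existsP; exists x0.
        by rewrite /= leqnn E.
    pose m3 := upd m2 (10 + d) (n - r).
    have hm3 : layout L e b m3 by apply: layout_upd => //; lia.
    have frame3 x : 9 < x < 10 + d -> m3 x = m0 x.
      by move=> hx'; rewrite /m3 updE; case: eqP => [|_]; [lia|apply: frame2].
    have hst3 : stores d env m3 by move=> i hi; rewrite hst0 // frame3 //; lia.
    have h3 : m3 (10 + d) = n - r by rewrite /m3 updE eqxx.
    have [m4 [k1 k2 k3 k4]] := IHr m3 hm3 hst3 (ltnW hr) h3.
    exists m4; split=> //.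
    + apply: (@runs_le _ (2 + time f n + (r * (time f n + 6) + 3).+3)); first by lia.
      apply: runs_trans R2 _; apply: (runs_step q0) => //=; rewrite g3 /=.
      apply: (runs_step q2) => //=.
      rewrite -[(q + 2).+1]addn1 -addnA (lay4 g2) g4 /m1 ?updE; last by lia.
      rewrite (_ : 10 + d == 6 = false); last by lia.
      rewrite hx (_ : n - r.+1 + 1 = n - r) -/m3; last by lia.
      by apply: (runs_step q3) => //=; rewrite (lay1 hm3).
    + rewrite k3; congr (nat_of_bool _); apply/existsP/existsP => -[x /andP[hx1 hx2]]; exists x.
        by rewrite hx2 andbT; lia.
      rewrite hx2 andbT; rewrite leq_eqVlt in hx1; case/orP: hx1 => [/eqP Ex|]; last by lia.
      have Ex0 : x = x0 by apply: val_inj; rewrite /= -Ex.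
      by rewrite Ex0 E in hx2.
    + by move=> x hx'; rewrite k4 // frame3.
  pose m0 := upd m (10 + d) 0.
  have hm0 : layout L e b m0 by apply: layout_upd => //; lia.
  have frame0 x : 9 < x < 10 + d -> m0 x = m x.
    by move=> hx'; rewrite /m0 updE; case: eqP => [|_]; [lia|].
  have hst0 : stores d env m0 by move=> i hi; rewrite hst // frame0 //; lia.
  have h0 : m0 (10 + d) = n - n by rewrite /m0 updE eqxx subnn.
  have [m' [k1 k2 k3 k4]] := loop n m0 hm0 hst0 (leqnn n) h0.
  exists m'; split=> //.
  + rewrite -[4]/(3.+1) addnS; apply: (runs_step c0) => //=.
    by rewrite -[pc.+1]addn1.
  + rewrite k3 subnn; congr (nat_of_bool _).
  + by move=> x hx; rewrite k4 // frame0.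
Qed.

End CompileCorrect.

(* The low registers overlap the input.  If n > L they only meet row 0, which
   symmetry duplicates in column 0; otherwise the whole matrix is first copied
   L * L + L cells higher. *)
Definition copy_code (L : nat) : seq instr :=
  [seq IAdd (L * L + L + x) x 1 | x <- iota 1 (L * L)].

Definition preamble (L : nat) : seq instr :=
  [:: IConst 1 L; ISub 1 0 1; IJz 1 8; IConst 1 0; IAdd 2 0 1; IConst 3 1;
      IConst 4 1; IJz 1 (8 + L * L + 3)] ++
  copy_code L ++ [:: IAdd 2 0 1; IConst 3 (L * L + L + 1); IConst 4 1].

Lemma size_preamble L : size (preamble L) = 8 + L * L + 3.
Proof. by rewrite /preamble !size_cat size_map size_iota /=; lia. Qed.

Lemma encodeE n (e : rel 'I_n) (i j : 'I_n) : encode n e (1 + i + j * n) = e j i.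
Proof.
rewrite /encode /= add1n addSn /=.
have n_gt0 : 0 < n by case: (n) i => [[]|].
have hi := ltn_ord i; have hj := ltn_ord j.
have -> : i + j * n < n * n by nia.
rewrite addnC divnMDl // modnMDl divn_small // modn_small // addn0.
congr (nat_of_bool _); apply/existsP/idP => [[x /existsP[y /and3P[/eqP Ex /eqP Ey]]]|h].
  by have -> : x = j by [apply: val_inj]; have -> : y = i by apply: val_inj.
by exists j; apply/existsP; exists i; rewrite !eqxx.
Qed.

Lemma encode1 n (e : rel 'I_n) : irreflexive e -> encode n e 1 = 0.
Proof.
case: n e => [|n] e irr; first by [].
by have := encodeE e ord0 ord0; rewrite /= irr.
Qed.

Lemma copy_correct L p pc m :
  has_code p pc (copy_code L) -> m 1 = 0 ->
  exists m', [/\ runs p (L * L) pc m (pc + L * L) m',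
    (forall x, 1 <= x <= L * L -> m' (L * L + L + x) = m x)
    & (forall x, x <= L * L + L -> m' x = m x)].
Proof.
move=> hc h1.
have E t : t < L * L -> nth IHalt p (pc + t) = IAdd (L * L + L + t.+1) t.+1 1.
  move=> ht; rewrite hc; last by rewrite size_map size_iota.
  by rewrite (nth_map 0) ?size_iota // nth_iota.
have : forall t, t <= L * L -> exists m', [/\ runs p t pc m (pc + t) m',
    (forall x, 1 <= x <= t -> m' (L * L + L + x) = m x)
    & (forall x, x <= L * L + L -> m' x = m x)].
  elim=> [|t IH] ht.
    by exists m; split; [rewrite addn0; apply: runs0 | lia |].
  have [m' [hr ha hb]] := IH (ltnW ht).
  exists (upd m' (L * L + L + t.+1) (m' t.+1 + m' 1)); split.
  - rewrite (addnS pc); apply: (@runs_le _ (t + 1)); first by rewrite addn1.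
    by apply: runs_trans hr _; apply: (runs_step (E t ht)) => //=; apply: runs0.
  - move=> x hx; rewrite updE eqn_add2l; case: eqP => [->|ne].
      by rewrite !hb ?h1 ?addn0 //; lia.
    by apply: ha; lia.
  - by move=> x hx; rewrite updE; case: eqP => [|_]; [lia|apply: hb].
by move=> /(_ (L * L) (leqnn _)).
Qed.

Lemma preamble_correct L p n (e : rel 'I_n) :
  4 < L -> has_code p 0 (preamble L) -> symmetric e -> irreflexive e ->
  exists b m, runs p (L * L + 8) 0 (encode n e) (size (preamble L)) m /\ layout L e b m.
Proof.
move=> hL hc sym irr; rewrite size_preamble.
set m0 := encode n e; pose m1 := upd (upd m0 1 L) 1 (n - L).
have c0 := hc 0 isT; have c1 := hc 1 isT; have c2 := hc 2 isT; rewrite /= in c0 c1 c2.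
have R1 : runs p 3 0 m0 (if n - L == 0 then 8 else 3) m1.
  apply: (runs_step c0) => //=; apply: (runs_step c1) => //=.
  rewrite (_ : upd m0 1 L 0 - upd m0 1 L 1 = n - L) // -/m1.
  by apply: (runs_step c2) => //=; apply: runs0.
have m10 : m1 0 = n by [].
have m11 : m1 1 = n - L by [].
(* If [n - L = 0], the matrix is small and must be moved; register 1 then already holds the 0 that
   the copying additions use. *)
case: eqP R1 => hn R1.
  have hc8 := has_code_catr hc.
  have [m2 [R2 ha hb]] := copy_correct (has_code_catl hc8) (etrans m11 hn).
  have := has_code_catr hc8; rewrite size_map size_iota /= => hc9.
  pose q := 8 + L * L.
  have d0 : nth IHalt p (q + 0) = IAdd 2 0 1 by exact: hc9 0 isT.
  have d1 : nth IHalt p (q + 1) = IConst 3 (L * L + L + 1) by exact: hc9 1 isT.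
  have d2 : nth IHalt p (q + 2) = IConst 4 1 by exact: hc9 2 isT.
  pose m3 := upd (upd (upd m2 2 n) 3 (L * L + L + 1)) 4 1.
  have m20 : m2 0 = n by rewrite hb.
  have m21 : m2 1 = 0 by rewrite hb ?m11 //; lia.
  exists (L * L + L), m3; split.
    apply: (@runs_le _ (3 + (L * L + 3))); first by lia.
    apply: runs_trans R1 _; apply: runs_trans R2 _.
    rewrite /= -/q -[q]addn0.
    apply: (runs_step d0) => //=; rewrite m20 m21 (addn0 n) -(addnS q 0).
    apply: (runs_step d1) => //=; rewrite -(addnS q 1).
    apply: (runs_step d2) => //=; rewrite -(addnS q 2) -/m3 addn0.
    exact: runs0.
  split=> //; first by rewrite /m3 !updE /= addn1.
    move=> i j hij.
    have -> : (L * L + L).+1 + i + j * n = L * L + L + (1 + i + j * n) by lia.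
    have hi := ltn_ord i; have hj := ltn_ord j.
    have Lb : 1 <= 1 + i + j * n <= L * L by nia.
    rewrite /m3 !updE.
    do 3![case: eqP => [|_]; first by lia].
    (* Input cell 1 was overwritten by [n - L], which is 0 here and hence still equals the diagonal
       entry (0,0). *)
    by rewrite ha // sym -encodeE /m1 !updE; case: eqP => // E; rewrite E encode1 //; lia.
  by move=> i j hij; right; lia.
have hnL : L < n by lia.
have c3 := hc 3 isT; have c4 := hc 4 isT; have c5 := hc 5 isT; have c6 := hc 6 isT.
have c7 := hc 7 isT; rewrite /= in c3 c4 c5 c6 c7.
pose m3 := upd (upd (upd (upd m1 1 0) 2 n) 3 1) 4 1.
exists 0, m3; split.
  apply: (@runs_le _ (3 + 5)); first by lia.
  apply: runs_trans R1 _.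
  apply: (runs_step c3) => //=; apply: (runs_step c4) => //=.
  rewrite (_ : upd m1 1 0 0 + upd m1 1 0 1 = n); last by rewrite !updE /= m10 addn0.
  apply: (runs_step c5) => //=; apply: (runs_step c6) => //=.
  by rewrite -/m3; apply: (runs_step c7) => //=; apply: runs0.
(* On or below the diagonal only (0,0) lies in row 0; every other entry has an address beyond [n],
   hence beyond all registers in use. *)
have far (i j : 'I_n) : i <= j -> 1 + i + j * n = 1 \/ n < 1 + i + j * n.
  by move=> hij; case: (posnP j) => hj; [left|right]; nia.
split=> //.
- move=> i j hij; rewrite sym -encodeE.
  case: (far i j hij) => h.
    by rewrite h /m3 !updE /= encode1.
  by rewrite /m3 /m1 !updE; do 4![case: eqP => [|_]; first by lia].
- by move=> i j hij; case: (far i j hij) => h; [left|right; lia].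
Qed.

Definition program (phi : form) : seq instr :=
  let P := preamble (10 + qdepth phi) in
  P ++ compile 0 (size P) phi ++ [:: IAdd 0 5 1; IHalt].

Lemma exec_halt p f pc m : nth IHalt p pc = IHalt -> exec p f.+1 pc m = Some m.
Proof. by rewrite /= => ->. Qed.

Lemma program_correct phi : exists c, forall n (e : rel 'I_n),
  symmetric e -> irreflexive e ->
  exists m, exec (program phi) (c * n.+1 ^ c) 0 (encode n e) = Some m /\
    (m 0 != 0) = eval (G := graph_of n e) phi [::].
Proof.
have [c hc] := time_poly phi.
pose L := 10 + qdepth phi.
(* Preamble, formula and final addition take at most [L * L + 8], [time phi n] and 1 steps; the
   surplus leaves fuel for [IHalt]. *)
exists (c + L * L + 11) => n e sym irr.
set p := program phi.
have hc0 : has_code p 0 p by [].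
have hp := has_code_catl hc0; have hr := has_code_catr hc0.
have hL : 4 < L by rewrite /L; lia.
have [b [m0 [R0 hm0]]] := preamble_correct hL hp sym irr.
rewrite add0n in hr.
have st0 : stores 0 ([::] : seq 'I_n) m0 by [].
have [m1 [R1 hm1 h5 _]] := comp_correct sym (erefl : size [::] = 0) (leqnn _) (has_code_catl hr) hm0 st0.
have he := has_code_catr hr.
set q := size _ + size _ in he R1.
have e0 : nth IHalt p q = IAdd 0 5 1 by have := he 0 isT; rewrite addn0.
have e1 : nth IHalt p (q + 1) = IHalt by exact: he 1 isT.
exists (upd m1 0 (m1 5 + m1 1)).
have [s hs Es] : runs p (L * L + 8 + time phi n + 1) 0 (encode n e) (q + 1) (upd m1 0 (m1 5 + m1 1)).
  apply: runs_trans; first exact: runs_trans R0 R1.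
  by apply: (runs_step e0) => //; rewrite /= addn1; apply: runs0.
have hB : s < (c + L * L + 11) * n.+1 ^ (c + L * L + 11).
  have h1 : n.+1 ^ c <= n.+1 ^ (c + L * L + 11) by apply: leq_pexp2l => //; lia.
  have h2 : 0 < n.+1 ^ (c + L * L + 11) by rewrite expn_gt0.
  have h3 := hc n.
  move: h1 h2 h3 hs; move: (n.+1 ^ (c + L * L + 11)) => X.
  move: (n.+1 ^ c) (time phi n) (L * L) => Y T Q.
  move=> h1 h2 h3 hs; have h4 : c * Y <= c * X by rewrite leq_mul2l h1 orbT.
  rewrite !mulnDl; have : Q <= Q * X by rewrite leq_pmulr.
  by lia.
split; last first.
  by rewrite updE /= h5 (lay1 hm1) addn0; case: (eval _ _).
rewrite -(subnKC (ltnW hB)) Es.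
case: (_ - s) (subn_gt0 s ((c + L * L + 11) * n.+1 ^ (c + L * L + 11))) => [|f _]; first by rewrite hB.
exact: exec_halt.
Qed.

(* [fo I P]: [P G rho] is first-order definable, uniformly in the graph [G],
   from the vertices [rho i], [i : I]. *)
Definition fo (I : Type) (P : forall G : sgraph, (I -> G) -> Prop) :=
  forall d (v : I -> nat), (forall i, v i < d) ->
  exists phi, forall (G : sgraph) (env : seq G) (rho : I -> G),
    size env = d -> (forall i, onth env (v i) = Some (rho i)) ->
    eval phi env <-> P G rho.

(** * Closure properties of first-order definability *)

Lemma fo_adj I (i j : I) : fo (fun G rho => adj G (rho i) (rho j)).
Proof. by move=> d v hv; exists (FAdj (v i) (v j)) => G env rho _ h /=; rewrite !h. Qed.

Lemma fo_eq I (i j : I) : fo (fun G rho => rho i = rho j).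
Proof.
by move=> d v hv; exists (FEq (v i) (v j)) => G env rho _ h /=; rewrite !h; split=> /eqP.
Qed.

Lemma fo_iff I (P Q : forall G : sgraph, (I -> G) -> Prop) :
  (forall G rho, P G rho <-> Q G rho) -> fo P -> fo Q.
Proof.
move=> h hP d v hv; have [phi hphi] := hP d v hv.
by exists phi => G env rho hs hr; rewrite -h; apply: hphi.
Qed.

Lemma fo_not I P : @fo I P -> fo (fun G rho => ~ P G rho).
Proof.
move=> hP d v hv; have [phi hphi] := hP d v hv; exists (FNot phi) => G env rho hs hr /=.
have h := hphi G env rho hs hr.
by split=> [/negP H /h|H]; [|apply/negP => /h].
Qed.

Lemma fo_and I P Q : @fo I P -> @fo I Q -> fo (fun G rho => P G rho /\ Q G rho).
Proof.
move=> hP hQ d v hv; have [phi hphi] := hP d v hv; have [psi hpsi] := hQ d v hv.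
exists (FAnd phi psi) => G env rho hs hr /=.
have h := hphi G env rho hs hr; have h' := hpsi G env rho hs hr.
by split=> [/andP[/h ? /h' ?]|[/h -> /h' ->]].
Qed.

Lemma fo_or I P Q : @fo I P -> @fo I Q -> fo (fun G rho => P G rho \/ Q G rho).
Proof.
move=> hP hQ d v hv; have [phi hphi] := hP d v hv; have [psi hpsi] := hQ d v hv.
exists (FNot (FAnd (FNot phi) (FNot psi))) => G env rho hs hr /=.
have h := hphi G env rho hs hr; have h' := hpsi G env rho hs hr.
rewrite negb_and !negbK.
by split=> [/orP[/h|/h']|[/h ->|/h' ->]]; [left|right|by []|exact: orbT].
Qed.

Lemma fo_imp I P Q : @fo I P -> @fo I Q -> fo (fun G rho => P G rho -> Q G rho).
Proof.
move=> hP hQ d v hv; have [phi hphi] := hP d v hv; have [psi hpsi] := hQ d v hv.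
exists (FNot (FAnd phi (FNot psi))) => G env rho hs hr /=.
have h := hphi G env rho hs hr; have h' := hpsi G env rho hs hr.
rewrite negb_and negbK -implybE.
by split=> [/implyP H /h /H /h'|H]; [|apply/implyP => /h /H /h'].
Qed.

Lemma fo_ex I (P : forall G : sgraph, (I -> G) -> G -> Prop) :
  @fo (option I) (fun G rho => P G (fun i => rho (Some i)) (rho None)) ->
  fo (fun G rho => exists x, P G rho x).
Proof.
move=> hP d v hv; pose v' o := if o is Some i then v i else d.
have hv' o : v' o < d.+1 by case: o => [i|] //=; apply: leqW (hv i).
have [phi hphi] := hP d.+1 v' hv'; exists (FEx phi) => G env rho hs hr /=.
have h x := hphi G (rcons env x) (fun o => if o is Some i then rho i else x).
have h' x : eval phi (rcons env x) <-> P G rho x.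
  apply: h; first by rewrite size_rcons hs.
  by move=> [i|] /=; rewrite onth_rcons hs ?hv // ltnn eqxx.
by split=> [/existsP[x /h']|[x /h' hx]]; [exists x|apply/existsP; exists x].
Qed.

Lemma fo_all I (P : forall G : sgraph, (I -> G) -> G -> Prop) :
  @fo (option I) (fun G rho => P G (fun i => rho (Some i)) (rho None)) ->
  fo (fun G rho => forall x, P G rho x).
Proof.
move=> hP d v hv; pose v' o := if o is Some i then v i else d.
have hv' o : v' o < d.+1 by case: o => [i|] //=; apply: leqW (hv i).
have [phi hphi] := hP d.+1 v' hv'; exists (FNot (FEx (FNot phi))) => G env rho hs hr /=.
have h x := hphi G (rcons env x) (fun o => if o is Some i then rho i else x).
have h' x : eval phi (rcons env x) <-> P G rho x.
  apply: h; first by rewrite size_rcons hs.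
  by move=> [i|] /=; rewrite onth_rcons hs ?hv // ltnn eqxx.
by split=> [/existsPn H x|H]; [apply/h'/negPn|apply/existsPn => x; apply/negPn/h'].
Qed.

Lemma fo_exists_in (J : finType) I (P : J -> forall G : sgraph, (I -> G) -> Prop) :
  (forall j, fo (P j)) -> fo (fun G rho => exists j, P j G rho).
Proof.
move=> hP.
have H (s : seq J) : fo (fun G (rho : I -> G) => exists2 j, j \in s & P j G rho).
  elim: s => [|j s IH].
    (* Position [d] lies outside an environment of size [d], so [FEq d d] is false. *)
    move=> d v hv; exists (FEq d d) => G env rho hs hr /=.
    by rewrite (onth_oob (s := env)) ?hs //; split=> // -[].
  refine (@fo_iff _ _ _ _ (fo_or (hP j) IH)) => G rho; split.
    by case=> [h|[i hi h]]; [exists j => //|exists i => //]; rewrite inE ?eqxx ?hi ?orbT.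
  by case=> i; rewrite inE => /orP[/eqP->|hi] h; [left|right; exists i].
refine (@fo_iff _ _ _ _ (H (enum J))) => G rho; split=> [[j _ h]|[j h]]; exists j => //.
by rewrite mem_enum.
Qed.

Lemma fo_forall_in (J : finType) I (P : J -> forall G : sgraph, (I -> G) -> Prop) :
  (forall j, fo (P j)) -> fo (fun G rho => forall j, P j G rho).
Proof.
move=> hP d v hv.
have [phi hphi] := fo_not (fo_exists_in (fun j => fo_not (hP j))) hv.
exists phi => G env rho hs hr; rewrite hphi //; split=> [h j|h [j]]; last exact.
have [psi hpsi] := hP j d v hv.
apply/(hpsi G env rho hs hr)/negPn/negP => hn; apply: h; exists j.
by move/(hpsi G env rho hs hr) => h; rewrite h in hn.
Qed.

Lemma ord0_false : 'I_0 -> False.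
Proof. by case. Qed.

(** A tuple of fixed length amounts to [s] nested element quantifiers; this keeps quantification
    over ['I_s -> G], and so over sets of bounded size, first-order. *)
Lemma fo_exs s I (P : forall G : sgraph, (I -> G) -> ('I_s -> G) -> Prop) :
  @fo (I + 'I_s) (fun G rho => P G (fun i => rho (inl i)) (fun j => rho (inr j))) ->
  fo (fun G rho => exists f, P G rho f).
Proof.
move=> hP d v hv.
pose w (o : I + 'I_s) := match o with inl i => v i | inr j => d + j end.
have hw o : w o < d + s by case: o => [i|j] /=; [have := hv i; lia|have := ltn_ord j; lia].
have [phi hphi] := hP (d + s) w hw.
exists (iter s FEx phi) => G env rho hs hr.
have evalE r (e : seq G) : eval (iter r FEx phi) e <->
    exists t, size t = r /\ eval phi (e ++ t).
  elim: r e => [|r IH] e /=.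
    by split=> [h|[t [/size0nil -> ]]]; [exists [::]; rewrite cats0|rewrite cats0].
  split=> [/existsP[x /IH[t [ht h]]]|[[|x t] [ht h]]] //.
    by exists (x :: t); rewrite /= ht -cat_rcons.
  by case: ht => ht; apply/existsP; exists x; apply/IH; exists t; rewrite cat_rcons.
have onth_catE (e t : seq G) i : onth (e ++ t) i =
    if i < size e then onth e i else onth t (i - size e).
  by elim: e i => [|y e IH] [|i] //=; rewrite IH.
have onth_nthE (t : seq G) x0 i : i < size t -> onth t i = Some (nth x0 t i).
  by elim: t i => [|y t IH] [|i] //=; apply: IH.
rewrite evalE; split=> [[t [ht h]]|[f hf]].
  have : exists f : 'I_s -> G, forall j : 'I_s, onth t j = Some (f j).
    case: t ht {h} => [|x t] ht; last first.
      by exists (fun j : 'I_s => nth x (x :: t) j) => j; apply: onth_nthE; rewrite ht.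
    by move: ht => /= E; subst s; exists (fun j => match ord0_false j with end); case.
  case=> f hf; exists f.
  apply/(hphi G (env ++ t) (fun o => match o with inl i => rho i | inr j => f j end)) => //.
    by rewrite size_cat hs ht.
  move=> [i|j] /=; rewrite onth_catE hs; first by rewrite hv.
  by rewrite ltnNge leq_addr /= addKn.
exists [seq f j | j <- enum 'I_s]; split; first by rewrite size_map size_enum_ord.
apply/(hphi G _ (fun o => match o with inl i => rho i | inr j => f j end)) => //.
  by rewrite size_cat hs size_map size_enum_ord.
move=> [i|j] /=; rewrite onth_catE hs; first by rewrite hv.
rewrite ltnNge leq_addr /= addKn.
rewrite (onth_nthE _ (f j)); last by rewrite size_map size_enum_ord.
by rewrite (nth_map j) ?size_enum_ord // nth_ord_enum.
Qed.

(** * Contractions and friendly triples *)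

Definition min_sds (G : sgraph) (D : {set G}) :=
  semitotal_dom D /\ forall D' : {set G}, semitotal_dom D' -> #|D| <= #|D'|.

Definition friendly (G : sgraph) (D : {set G}) :=
  exists x y z, [/\ x \in D, y \in D, z \in D, adj G x y & [/\ z != x, z != y & within2 y z]].

Definition reducible (G : sgraph) := exists2 D : {set G}, min_sds D & friendly D.

Section Contraction.
Variables (G H : sgraph) (u v : G) (f : G -> H).
Hypotheses (symG : symmetric (adj G)) (irrG : irreflexive (adj G)) (adj_uv : adj G u v).
Hypothesis fuv : f u = f v.
Hypothesis f_inj : forall x y, f x = f y -> x = y \/ (x = u /\ y = v) \/ (x = v /\ y = u).
Hypothesis adjH : forall a b : H, adj H a b = (a != b) &&
  [exists x : G, exists y : G, [&& f x == a, f y == b & adj G x y]].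

Lemma contraction_adj a b : adj H a b ->
  a <> b /\ exists x y, [/\ f x = a, f y = b & adj G x y].
Proof.
rewrite adjH => /andP[/eqP ne /existsP[x /existsP[y /and3P[/eqP Ex /eqP Ey h]]]].
by split=> //; exists x, y.
Qed.

(** A walk of length two in [H] lifts to one in [G] unless its midpoint is the merged vertex and its
    two halves lift to different ends of the edge [uv]. *)
Lemma contraction_within2 a b : within2 a b ->
  exists x y, [/\ f x = a, f y = b & within2 x y \/
    exists r s, [/\ adj G x r, adj G s y & (r = u /\ s = v) \/ (r = v /\ s = u)]].
Proof.
case/orP=> [/contraction_adj[_ [x [y [fx fy xy]]]]|].
  by exists x, y; split=> //; left; rewrite /within2 xy.
case/existsP=> c /andP[/contraction_adj[_ [x [r [fx fr xr]]]]].
case/contraction_adj=> _ [s [y [fs fy sy]]].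
exists x, y; split=> //; have [E|E] : r = s \/ (r = u /\ s = v) \/ (r = v /\ s = u).
- by apply: f_inj; rewrite fr fs.
- by left; apply/orP; right; apply/existsP; exists r; rewrite xr E.
- by right; exists r, s.
Qed.

(** Pulling [D'] back costs at most one extra vertex. If the merged vertex is in [D'], its two
    preimages and a lifted witness form a friendly triple. Otherwise an end [u1] of the contracted
    edge with a neighbour [d] in the pullback is added; pairs whose link is lost by splitting the
    merged vertex are both within distance two of [u1]. *)
Lemma contraction_lift (D' : {set H}) : semitotal_dom D' ->
  exists D : {set G}, [/\ semitotal_dom D, friendly D & #|D| <= #|D'|.+1].
Proof.
move=> [dom sem].
pose D0 := [set x | f x \in D'].
have fib x y : f x = f y -> y != u -> y != v -> x = y.
  by move=> /f_inj[//|[[_ ->]|[_ ->]]]; rewrite eqxx.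
have uv : u != v by apply: contraTneq adj_uv => ->; rewrite irrG.
have cardD0 (S : {set G}) : S \subset D0 -> (u \notin S) || (v \notin S) -> #|S| <= #|D'|.
  move=> sub nuv; rewrite -(@card_in_imset _ _ f S).
    apply: subset_leq_card; apply/subsetP => _ /imsetP[x /(subsetP sub) + ->].
    by rewrite inE.
  move=> x y xS yS /f_inj[//|[[Ex Ey]|[Ex Ey]]]; subst x y; by rewrite xS yS in nuv.
case: (boolP (f u \in D')) => fu.
  have uD : u \in D0 by rewrite inE.
  have vD : v \in D0 by rewrite inE -fuv.
  exists D0; split; first split.
  - move=> x; rewrite inE => hx; have [b bD] := dom _ hx.
    case/contraction_adj=> _ [x' [y [fx' fy xy]]].
    have E : x' = x by apply: fib => //; apply: contraNneq hx => ->; rewrite -?fuv.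
    by exists y; [rewrite inE fy|rewrite -E].
  - move=> t tD; have [->|tu] := eqVneq t u.
      by exists v => //; rewrite eq_sym uv /within2 adj_uv.
    have [->|tv] := eqVneq t v; first by exists u => //; rewrite uv /within2 symG adj_uv.
    have [b bD /andP[bt]] : exists2 w, w \in D' & (w != f t) && within2 (f t) w.
      by apply: sem; move: tD; rewrite inE.
    case/contraction_within2=> t' [y [ft' fy [hw|[r [s [tr sy rs]]]]]].
      have E : t' = t by apply: fib.
      exists y; first by rewrite inE fy.
      by rewrite -{2}E hw andbT; apply: contraNneq bt => <-; rewrite fy.
    have E : t' = t by apply: fib.
    exists r; first by case: rs => -[-> _].
    rewrite E in tr; rewrite /within2 tr andbT.
    by case: rs => -[-> _]; rewrite eq_sym.
  - have [b bD /andP[bu]] := sem _ fu.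
    case/contraction_within2=> x [y [fx fy h]].
    have yD : y \in D0 by rewrite inE fy.
    have yu : y != u by apply: contraNneq bu => <-; rewrite fy.
    have yv : y != v by apply: contraNneq bu => E; rewrite -fy E fuv.
    have xuv : x = u \/ x = v by case: (f_inj fx) => [|[[]|[]]]; auto.
    have hw : within2 x y.
      case: h => // -[r [s [xr sy rs]]].
      by case: xuv rs xr sy => -> [] [-> ->]; rewrite ?irrG // /within2 => _ ->.
    by case: xuv hw => -> hw; [exists v, u, y|exists u, v, y]; split=> //; rewrite symG.
  - have := cardD0 (D0 :\ v); rewrite subD1set !inE eqxx /= orbT => /(_ isT isT).
    by rewrite (cardsD1 v D0) vD.
have [b bD] := dom _ fu.
case/contraction_adj=> _ [u1 [d [fu1 fd ud]]].
have dD : d \in D0 by rewrite inE fd.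
have D0uv t : t \in D0 -> t != u /\ t != v.
  rewrite inE => tD; split; apply: contraNneq fu; first by move=> <-.
  by rewrite fuv => <-.
have [v1 [uv1 vv fv1]] : exists v1, [/\ adj G u1 v1, (u1 = u /\ v1 = v) \/ (u1 = v /\ v1 = u) & f v1 = f u].
  case: (f_inj fu1) => [E|[[E E']|[E E']]].
  - by exists v; rewrite E; split=> //; left.
  - by move: uv; rewrite E' eqxx.
  - by exists u; rewrite E symG; split=> //; right.
have near r s t : (r = u /\ s = v) \/ (r = v /\ s = u) -> adj G r t -> within2 u1 t.
  move=> rs.
  have [->|->] : r = u1 \/ r = v1 by case: rs vv => -[-> _] [] [-> ->]; auto.
    by rewrite /within2 => ->.
  by move=> rt; apply/orP; right; apply/existsP; exists v1; rewrite uv1.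
have within2_sym x y : within2 x y -> @within2 G y x.
  case/orP=> [h|/existsP[z /andP[h1 h2]]]; rewrite /within2; first by rewrite symG h.
  by apply/orP; right; apply/existsP; exists z; rewrite symG h2 symG h1.
have u1D : u1 \notin D0 by rewrite inE fu1.
have fibD t' t : f t' = f t -> t \in D0 -> t' = t.
  by move=> ft /D0uv[h1 h2]; apply: fib.
have key t : t \in D0 -> exists2 w, w \in D0 & w != t /\ (within2 t w \/ (within2 u1 t /\ within2 u1 w)).
  move=> tD; have [c cD /andP[ct]] : exists2 w, w \in D' & (w != f t) && within2 (f t) w.
    by apply: sem; move: tD; rewrite inE.
  case/contraction_within2=> t' [y [/fibD/(_ tD) -> fy h]].
  exists y; first by rewrite inE fy.
  split; first by apply: contraNneq ct => <-; rewrite fy.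
  case: h => [|[r [s [tr sy rs]]]]; [by left|right; split].
    by apply: (near r s) => //; rewrite symG.
  by apply: (near s r) => //; case: rs => -[-> ->]; auto.
exists (u1 |: D0); split; first split.
- move=> x; rewrite !inE negb_or => /andP[xu1 hx].
  have [E|xv1] := eqVneq x v1.
    by exists u1; [rewrite setU11|rewrite E symG].
  have [c cD] := dom _ hx; case/contraction_adj=> _ [x' [y [fx fy xy]]].
  have E : x' = x by case: vv xu1 xv1 => -[-> ->] h1 h2; apply: fib.
  by exists y; rewrite ?inE ?fy ?cD ?orbT // -E.
- move=> t; rewrite in_setU1 => /orP[/eqP->|tD].
    exists d; first by rewrite in_setU1 dD orbT.
    by rewrite /within2 ud andbT; apply: contraNneq u1D => <-.
  have [w wD [wt [h|[h _]]]] := key t tD.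
    by exists w; [rewrite in_setU1 wD orbT|rewrite wt].
  exists u1; first exact: setU11.
  by rewrite within2_sym // andbT; apply: contraNneq u1D => ->.
- have [w wD [wd h]] := key d dD.
  have wu : w != u1 by apply: contraNneq u1D => <-.
  have du : d != u1 by apply: contraNneq u1D => <-.
  (* If [d] keeps its witness [w], then [d] is the middle of the triple; otherwise [w] lies near
     [u1], which becomes the middle. *)
  case: h => [h|[_ h]]; [exists u1, d, w|exists d, u1, w]; split; rewrite ?in_setU1 ?eqxx ?dD ?wD ?orbT //.
  by rewrite symG.
- rewrite cardsU1 u1D add1n ltnS; apply: cardD0 => //.
  by apply/orP; left; apply/negP => /D0uv[]; rewrite eqxx.
Qed.

End Contraction.

Lemma contracts0_eq k G H : contracts k G H -> k = 0 -> H = G.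
Proof. by case. Qed.

Lemma ct_le1_reducible (G : sgraph) : simple_graph G -> ct_le1 G -> reducible G.
Proof.
move=> simG [k [G' [k1 hc hlt]]].
case: k G G' / hc simG k1 hlt => [K|k K H K' u v cont hc] [sym irr] k1 [D' sD' hD'].
  by have := hD' _ sD'; rewrite ltnn.
have k0 : k = 0 by lia.
have E := contracts0_eq hc k0; subst K'.
case: cont => uv [f [_ fuv f_inj adjH]].
have [D [sD fD cD]] := contraction_lift sym irr uv fuv f_inj adjH sD'.
exists D => //; split=> // D0 sD0; exact: leq_trans cD (hD' _ sD0).
Qed.

Lemma reducible_ct_le1 (G : sgraph) : simple_graph G -> reducible G -> ct_le1 G.
Proof.
move=> [sym irr] [D [[domD semD] minD] [x [y [z [xD yD zD xy [zx zy yz]]]]]].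
have xny : x != y by apply: contraTneq xy => ->; rewrite irr.
pose T : finType := {a : G | a != y}.
(* The edge is contracted onto [x]: the default of [insubd] sends [y], the only vertex outside [T],
   to [x]. *)
pose f (a : G) : T := insubd (exist (fun a => a != y) x xny) a.
have fE a : a != y -> val (f a) = a by move=> ay; rewrite val_insubd ay.
have fy : val (f y) = x by rewrite val_insubd eqxx.
have fx : val (f x) = x by rewrite fE.
have fxy : f x = f y by apply: val_inj; rewrite fy fx.
pose H := SGraph (fun a b : T => (a != b) &&
   [exists p : G, exists q : G, [&& f p == a, f q == b & adj G p q]]).
have adjHI p q : adj G p q -> f p != f q -> adj H (f p) (f q).
  by move=> pq ne; rewrite /= ne; apply/existsP; exists p; apply/existsP; exists q; rewrite !eqxx.
have f_inj p q : f p = f q -> p = q \/ (p = x /\ q = y) \/ (p = y /\ q = x).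
  move=> E; have [py|py] := eqVneq p y; have [qy|qy] := eqVneq q y.
  - by left; rewrite py qy.
  - by right; right; rewrite -(fE q qy) -E py fy.
  - by right; left; rewrite -(fE p py) E qy fy.
  - by left; rewrite -(fE p py) E fE.
have contr : contraction_of G H x y.
  split=> //; exists f; split=> //.
  by move=> a; exists (val a); apply: val_inj; rewrite fE // (valP a).
have w2 p q : within2 p q -> f p != f q -> @within2 H (f p) (f q).
  move=> h ne; case/orP: h => [/adjHI/(_ ne) h|/existsP[r /andP[pr rq]]].
    by rewrite /within2 h.
  have [E|pr'] := eqVneq (f p) (f r).
    by rewrite /within2 E adjHI // -E.
  have [E|rq'] := eqVneq (f r) (f q).
    by rewrite /within2 -E adjHI // E.
  apply/orP; right; apply/existsP; exists (f r); apply/andP.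
  by split; apply: adjHI.
pose D' : {set H} := f @: D.
have sD' : semitotal_dom D'.
  split=> [a aD|a /imsetP[p pD ->]].
    have Ea : f (val a) = a by apply: val_inj; rewrite fE // (valP a).
    have pD : val a \notin D by apply: contraNN aD => h; rewrite -Ea imset_f.
    have [q qD pq] := domD _ pD; exists (f q); first exact: imset_f.
    rewrite -{1}Ea; apply: adjHI => //; rewrite Ea.
    by apply: contraNneq aD => ->; apply: imset_f.
  (* Merging [x] and [y] can only destroy their being witnesses for each other, and [z] steps in for
     them. *)
  have [E|pxy] := eqVneq (f p) (f y).
    have zfy : f z != f y by apply/eqP => /f_inj[E'|[[E' _]|[E' _]]]; move: zx zy; rewrite E' eqxx.
    by exists (f z); [apply: imset_f|rewrite E zfy w2 // eq_sym].
  have [q qD /andP[qp pq]] := semD _ pD.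
  have ne : f q != f p.
    apply/eqP => /f_inj[E'|[[_ E']|[_ E']]].
    - by rewrite E' eqxx in qp.
    - by rewrite E' eqxx in pxy.
    - by rewrite E' fxy eqxx in pxy.
  by exists (f q); [apply: imset_f|rewrite ne w2 // eq_sym].
exists 1, H; split=> //; first exact: contractsS contr (contracts0 H).
exists D' => // D0 /minD; apply: leq_trans; rewrite (cardsD1 y D) yD add1n ltnS.
apply: leq_trans (leq_imset_card f (D :\ y)); apply: subset_leq_card.
apply/subsetP => _ /imsetP[p pD ->]; have [->|py] := eqVneq p y.
  by rewrite -fxy; apply: imset_f; rewrite !inE xny.
by apply: imset_f; rewrite !inE py.
Qed.

(** * Hubs and cliques *)

Definition p3 (G : sgraph) (a b c : G) :=
  [&& adj G a b, adj G b c, ~~ adj G a c & a != c].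

Definition anti (G : sgraph) (p q : G * G) :=
  [&& ~~ adj G p.1 q.1, ~~ adj G p.1 q.2, ~~ adj G p.2 q.1 & ~~ adj G p.2 q.2].

Definition far (G : sgraph) (x : G) (p : G * G) := ~~ adj G x p.1 && ~~ adj G x p.2.

Definition matching (G : sgraph) (I : Type) (M : I -> G * G) :=
  (forall i, adj G (M i).1 (M i).2) /\ (forall i j, i <> j -> anti (M i) (M j)).

(** Distinctness of the [2k + 3] vertices need not be demanded: a vertex shared with a matching edge
    would be adjacent to its partner there, against [anti] or [far]. *)
Definition p3_matching (G : sgraph) (k : nat) :=
  exists a b c (M : 'I_k -> G * G), [/\ p3 a b c, matching M &
    forall i, [&& far a (M i), far b (M i) & far c (M i)]].

(** Index arithmetic for the numbering of [p3kp2], in which leg [x] of edge [j] is vertex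
    [j.*2 + x + 3]. *)
Lemma succ_leg l : (l + 1 + 3 == (l + 0 + 3).+1) /\ (l + 0 + 3 == (l + 1 + 3).+1) = false.
Proof. by lia. Qed.

Lemma even_leg (p q : nat) : (p.*2 + 0 + 3 == (q.*2 + 0 + 3).+1) = false.
Proof. by lia. Qed.

Lemma neq_leg (p q : nat) : p <> q ->
  (p.*2 + 1 + 3 == (q.*2 + 0 + 3).+1) = false /\ (q.*2 + 1 + 3 == (p.*2 + 0 + 3).+1) = false.
Proof. by lia. Qed.

Lemma P3kP2_free_matching (G : sgraph) k :
  simple_graph G -> P3kP2_free k G -> ~ p3_matching G k.
Proof.
move=> [sym irr] free [a [b [c [M [/and4P[ab bc ac a_c] [Me Ma] Mf]]]]]; apply: free.
pose leg j (x : bool) := if insub j is Some o then (if x then (M o).2 else (M o).1) else a.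
pose g i := match i with 0 => a | 1 => b | 2 => c | i.+3 => leg i./2 (odd i) end.
have view (i : 'I_(3 + 2 * k)) : [\/ i = 0 :> nat, i = 1 :> nat, i = 2 :> nat |
    exists (j : 'I_k) (x : bool), i = j.*2 + x + 3 :> nat /\ g i = if x then (M j).2 else (M j).1].
  case: i => [[|[|[|i]]] hi]; [by constructor 1|by constructor 2|by constructor 3|].
  have hj : i./2 < k by lia.
  constructor 4; exists (Ordinal hj), (odd i); split=> /=.
    by have := odd_double_half i; lia.
  by rewrite /leg insubT.
have odd3 j (x : bool) : odd (j.*2 + x + 3) = ~~ x by rewrite !oddD odd_double /=; case: x.
have nz j (x : bool) : ((j.*2 + x + 3 == 0) = false) * ((j.*2 + x + 3 == 1) = false) *
    ((j.*2 + x + 3 == 2) = false) * ((2 < j.*2 + x + 3) = true) * ((0 == j.*2 + x + 3) = false) * ((1 == j.*2 + x + 3) = false)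
    * ((2 == (j.*2 + x + 3).+1) = false) * ((1 == (j.*2 + x + 3).+1) = false).
  by rewrite !addn3.
have g_adj (i j : 'I_(3 + 2 * k)) : adj G (g i) (g j) = p3kp2 k i j.
  have [ba cb ca] : [/\ adj G b a, adj G c b & adj G c a = false].
    by split; rewrite sym //; apply/negbTE.
  have farE (o : 'I_k) : [/\ (adj G a (M o).1 = false) * (adj G a (M o).2 = false),
     (adj G b (M o).1 = false) * (adj G b (M o).2 = false),
     (adj G c (M o).1 = false) * (adj G c (M o).2 = false) &
     (adj G (M o).1 a = false) * (adj G (M o).2 a = false) *
     (adj G (M o).1 b = false) * (adj G (M o).2 b = false) *
     (adj G (M o).1 c = false) * (adj G (M o).2 c = false)].
    have /and3P[/andP[/negbTE h1 /negbTE h2] /andP[/negbTE h3 /negbTE h4] /andP[/negbTE h5 /negbTE h6]] := Mf o.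
    have [g1 g2 g3] : [/\ adj G (M o).1 a = false, adj G (M o).1 b = false & adj G (M o).1 c = false].
      by split; rewrite sym.
    have [g4 g5 g6] : [/\ adj G (M o).2 a = false, adj G (M o).2 b = false & adj G (M o).2 c = false].
      by split; rewrite sym.
    by split; do ?split.
  rewrite /p3kp2 /p3kp2_nat.
  case: (view i) => [Ei|Ei|Ei|[o [x [Ei gi]]]]; case: (view j) => [Ej|Ej|Ej|[o' [x' [Ej gj]]]].
  all: try (rewrite ?gi ?gj).
  all: rewrite ?Ei ?Ej /= ?irr ?ab ?ba ?bc ?cb ?(negbTE ac) ?ca ?odd3 ?nz ?andbF //=.
  - by have [h _ _ _] := farE o'; case: x' {Ej gj}; rewrite h.
  - by have [_ h _ _] := farE o'; case: x' {Ej gj}; rewrite h.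
  - by have [_ _ h _] := farE o'; case: x' {Ej gj}; rewrite h.
  - by have [_ _ _ h] := farE o; case: x {Ei gi}; rewrite h ?andbF.
  - by have [_ _ _ h] := farE o; case: x {Ei gi}; rewrite h ?andbF.
  - by have [_ _ _ h] := farE o; case: x {Ei gi}; rewrite h ?andbF.
  have [E|ne] := eqVneq o o'.
    subst o'; have he := Me o; have he' : adj G (M o).2 (M o).1 by rewrite sym.
    have [h1 h2] := succ_leg (o.*2).
    by case: x {Ei gi}; case: x' {Ej gj} => /=; rewrite ?irr ?he ?he' ?h1 ?h2 ?orbT ?even_leg.
  have /and4P[/negbTE h1 /negbTE h2 /negbTE h3 /negbTE h4] := Ma o o' (elimN eqP ne).
  have neo : (o : nat) <> o' by move=> E; case/eqP: ne; apply: val_inj.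
  have [h5 h6] := neq_leg neo.
  by case: x {Ei gi}; case: x' {Ej gj} => /=; rewrite ?h1 ?h2 ?h3 ?h4 ?h5 ?h6 ?even_leg.
exists (fun i : 'I_(3 + 2 * k) => g i); split; last exact: g_adj.
have neq (o : 'I_k) (x : bool) y : far y (M o) -> y != if x then (M o).2 else (M o).1.
  case/andP=> h1 h2; case: x; last by apply: contraNneq h2 => ->.
  by apply: contraNneq h1 => ->; rewrite sym.
have ab' : a != b by apply: contraTneq ab => ->; rewrite irr.
have bc' : b != c by apply: contraTneq bc => ->; rewrite irr.
have lt_neq (i j : 'I_(3 + 2 * k)) : i < j -> g i != g j.
  case: (view i) => [Ei|Ei|Ei|[o [x [Ei gi]]]]; case: (view j) => [Ej|Ej|Ej|[o' [x' [Ej gj]]]].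
  all: try (by rewrite Ei Ej ?addn3).
  - by move=> _; rewrite gj Ei neq //; case/and3P: (Mf o').
  - by move=> _; rewrite gj Ei neq //; case/and3P: (Mf o').
  - by move=> _; rewrite gj Ei neq //; case/and3P: (Mf o').
  move=> hij; rewrite gi gj; have [E|ne] := eqVneq o o'.
    have he := Me o; have he' : (M o).1 != (M o).2 by apply: contraTneq he => ->; rewrite irr.
    subst o'; case: x {gi} Ei; case: x' {gj} Ej => Ej Ei.
    - by rewrite Ei Ej ltnn in hij.
    - by rewrite eq_sym.
    - exact: he'.
    - by rewrite Ei Ej ltnn in hij.
  apply: neq; have /and4P[h1 h2 h3 h4] := Ma o o' (elimN eqP ne).
  by case: x {gi Ei}; rewrite /far ?h1 ?h2 ?h3 ?h4.
move=> i j E; apply: val_inj => /=.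
by case: (ltngtP i j) => // /lt_neq; rewrite E eqxx.
Qed.

Lemma p3_matching_bound (G : sgraph) k (I : finType) (J : {set I}) (M : I -> G * G) a b c :
  ~ p3_matching G k -> p3 a b c ->
  {in J, forall i, adj G (M i).1 (M i).2} ->
  {in J &, forall i j, i <> j -> anti (M i) (M j)} ->
  {in J, forall i, [&& far a (M i), far b (M i) & far c (M i)]} -> #|J| < k.
Proof.
move=> free abc hE hA hF; rewrite ltnNge; apply/negP => hk; apply: free.
pose M' (i : 'I_k) := M (enum_val (widen_ord hk i)).
exists a, b, c, M'; split=> //.
  split=> [i|i j ij]; first by apply: hE; apply: enum_valP.
  apply: hA; try exact: enum_valP.
  by move=> /enum_val_inj /(congr1 val) /= E; apply: ij; apply: val_inj.
by move=> i; apply: hF; apply: enum_valP.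
Qed.

Lemma subset_card (T : finType) (A : {set T}) m : m <= #|A| ->
  exists B : {set T}, B \subset A /\ #|B| = m.
Proof.
move=> h; exists [set x in take m (enum A)]; split.
  by apply/subsetP => x; rewrite inE => /mem_take; rewrite mem_enum.
rewrite cardsE; have /card_uniqP -> : uniq (take m (enum A)) by rewrite take_uniq // enum_uniq.
by rewrite size_takel // -cardE.
Qed.

Section Hubs.
Variables (G : sgraph) (k w : nat) (M : 'I_w -> G * G).

Definition touch (v : G) (i : 'I_w) :=
  [|| v == (M i).1, v == (M i).2, adj G v (M i).1 | adj G v (M i).2].

Definition hub (v : G) :=
  [exists i, exists j, [&& i != j, touch v i & touch v j]].

Definition same (u v : G) := (u == v) || adj G u v.

(* No r <= q hubs together dominate r cliques of G minus the hubs. *)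
Definition no_trade (q : nat) := forall r : 'I_q, ~ exists hs cs : 'I_r.+1 -> G,
  (forall j, hub (hs j)) /\ (forall j, ~~ hub (cs j)) /\
  (forall i j, i != j -> ~~ same (cs i) (cs j)) /\
  (forall i y, ~~ hub y -> same y (cs i) -> exists j, adj G (hs j) y).

Hypotheses (sym : symmetric (adj G)) (irr : irreflexive (adj G)).
Hypotheses (free : ~ p3_matching G k) (matM : matching M).

Lemma same_sym u v : same u v = same v u.
Proof. by rewrite /same eq_sym sym. Qed.

(** Edges of an induced matching do not see each other. Consequently legs are never hubs, and
    different edges lie in different cliques. *)
Lemma touch_leg i j : touch (M i).1 j || touch (M i).2 j -> i = j.
Proof.
have [he ha] := matM; move=> h; apply/eqP; apply: contraTT h => /eqP ne.
have /and4P[h1 h2 h3 h4] := ha _ _ ne; have e1 := he i; have e2 := he j.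
rewrite /touch !negb_or h1 h2 h3 h4 !andbT; apply/andP; split; apply/andP; split.
- by apply: contraNneq h3 => <-; rewrite sym.
- by apply: contraNneq h4 => <-; rewrite sym.
- by apply: contraNneq h1 => <-.
- by apply: contraNneq h2 => <-.
Qed.

Lemma leg_nonhub i : ~~ hub (M i).1 /\ ~~ hub (M i).2.
Proof.
split; apply/existsPn => j; apply/existsPn => l; apply: contraT; rewrite negbK => /and3P[/eqP ne hj hl].
  by case: ne; rewrite -(@touch_leg i j) ?hj // -(@touch_leg i l) ?hl.
by case: ne; rewrite -(@touch_leg i j) ?hj ?orbT // -(@touch_leg i l) ?hl ?orbT.
Qed.

Lemma nonhub_touch v : ~~ hub v -> #|[set i | touch v i]| <= 1.
Proof.
move=> nh; apply/card_le1_eqP => i j; rewrite !inE => hi hj; apply/eqP.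
apply: contraNT nh => ne; apply/existsP; exists j; apply/existsP; exists i.
by rewrite ne hi hj.
Qed.

Lemma nontouch_far v i : ~~ touch v i -> far v (M i).
Proof. by rewrite /touch /far !negb_or => /and4P[_ _ -> ->]. Qed.

Hypothesis hw : k + 3 <= w.

(** Each of the three non-hubs touches at most one matching edge, so at least [w - 3 >= k] edges are
    far from the path. Hence the non-hubs induce disjoint cliques and [same] is an equivalence on
    them. *)
Lemma nonhub_p3_free a b c : ~~ hub a -> ~~ hub b -> ~~ hub c -> ~~ p3 a b c.
Proof.
move=> ha hb hc; apply/negP => abc.
pose J := [set i | ~~ touch a i && ~~ touch b i && ~~ touch c i].
have : #|J| < k.
  apply: (p3_matching_bound free abc (M := M)).
  - by move=> i _; case: matM.
  - by move=> i j _ _; case: matM => _; apply.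
  - by move=> i; rewrite inE => /andP[/andP[h1 h2] h3]; rewrite !nontouch_far.
have := cardsC J; rewrite card_ord.
have : #|~: J| <= #|[set i | touch a i]| + #|[set i | touch b i]| + #|[set i | touch c i]|.
  apply: leq_trans (leq_trans (leq_card_setU _ _) (leq_add (leq_card_setU _ _) (leqnn _))).
  apply: subset_leq_card; apply/subsetP => i; rewrite !inE.
  by rewrite !negb_and !negbK.
by move: (nonhub_touch ha) (nonhub_touch hb) (nonhub_touch hc) hw; clear; lia.
Qed.

Lemma same_trans u v t : ~~ hub u -> ~~ hub v -> ~~ hub t ->
  same u v -> same v t -> same u t.
Proof.
move=> hu hv ht /orP[/eqP->//|uv] /orP[/eqP<-|vt]; first by rewrite /same uv orbT.
have := nonhub_p3_free hu hv ht; rewrite /p3 uv vt /= negb_and !negbK.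
by rewrite /same orbC.
Qed.

Lemma same_adj u v c : ~~ hub u -> ~~ hub v -> ~~ hub c ->
  same u c -> same v c -> u != v -> adj G u v.
Proof.
move=> hu hv hc uc vc ne; have := same_trans hu hc hv uc; rewrite same_sym => /(_ vc).
by rewrite /same (negbTE ne).
Qed.

(* A set of representatives of distinct cliques of G minus the hubs. *)
Definition reps (Q : {set G}) :=
  {in Q, forall c, ~~ hub c} /\ {in Q &, forall c d, same c d -> c = d}.

(** Quantifying over pairs expresses that [h] misses at most one vertex of the clique of [c]. *)
Definition good (h c : G) := [forall u, forall v,
  [&& ~~ hub u, ~~ hub v, same u c, same v c & u != v] ==> adj G h u || adj G h v].

Lemma goodP h c u v : good h c -> ~~ hub u -> ~~ hub v -> same u c -> same v c ->
  u != v -> ~~ adj G h u -> adj G h v.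
Proof.
move=> /forallP/(_ u)/forallP/(_ v)/implyP g hu hv uc vc ne /negbTE nu.
by move: g; rewrite hu hv uc vc ne nu => /(_ isT).
Qed.

(** A hub has neighbours [y] and [z] in two matching edges, and [y], [h], [z] is an induced path. A
    clique with two vertices missed by [h] contributes an edge far from this path unless it contains
    [y] or [z]: fewer than [k] cliques plus two exceptions. *)
Lemma bad_bound h (Q : {set G}) : hub h -> reps Q -> #|[set c in Q | ~~ good h c]| <= k.+1.
Proof.
move=> hh [Qn Qs].
have [i [j [ij ti tj]]] : exists i j, [/\ i != j, touch h i & touch h j].
  by case/existsP: hh => i /existsP[j /and3P[? ? ?]]; exists i, j.
have legnbr i' : touch h i' -> exists y, [/\ y = (M i').1 \/ y = (M i').2 & adj G h y].
  have [n1 n2] := leg_nonhub i'.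
  case/or4P=> [/eqP E|/eqP E|a1|a2]; [by rewrite -E hh in n1|by rewrite -E hh in n2| |].
    by exists (M i').1; split; auto.
  by exists (M i').2; split; auto.
have [y [yi hy]] := legnbr _ ti; have [z [zj hz]] := legnbr _ tj.
have ny : ~~ hub y by have [? ?] := leg_nonhub i; case: yi => ->.
have nz : ~~ hub z by have [? ?] := leg_nonhub j; case: zj => ->.
have nyz : ~~ same y z.
  apply: contraNN ij => yz; apply/eqP; apply: touch_leg.
  case: yi zj yz => -> [] ->; rewrite /same /touch => /orP[->|->]; rewrite ?orbT //.
have yhz : p3 y h z.
  by rewrite /p3 sym hy hz /=; move: nyz; rewrite /same negb_or => /andP[-> ->].
pose J := [set c in Q | [&& ~~ good h c, ~~ same c y & ~~ same c z]].
pose F c := if [pick p : G * G | [&& ~~ hub p.1, ~~ hub p.2, same p.1 c, same p.2 c & p.1 != p.2]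
    && (~~ adj G h p.1 && ~~ adj G h p.2)] is Some p then p else (c, c).
have FP c : c \in J -> [/\ c \in Q, ~~ same c y & ~~ same c z] /\
    [/\ ~~ hub (F c).1 /\ ~~ hub (F c).2, same (F c).1 c /\ same (F c).2 c, (F c).1 != (F c).2
    & ~~ adj G h (F c).1 /\ ~~ adj G h (F c).2].
  rewrite inE => /andP[cQ /and3P[bad cy cz]]; split=> //; rewrite /F.
  case: pickP => [p /andP[/and5P[-> -> -> -> ->] /andP[-> ->]]//|no].
  case/negP: bad; apply/forallP => u; apply/forallP => v; apply/implyP => huv.
  by have := no (u, v); rewrite /= huv -negb_or => /negbT; rewrite negbK.
have JF : #|J| < k.
  apply: (p3_matching_bound free yhz (M := F)).
  - move=> c /FP[[cQ _ _] [[n1 n2] [s1 s2] ne _]].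
    exact: same_adj n1 n2 (Qn _ cQ) s1 s2 ne.
  - move=> c d /FP[[cQ _ _] [[n1 n2] [s1 s2] _ _]] /FP[[dQ _ _] [[m1 m2] [t1 t2] _ _]] cd.
    have key u v : ~~ hub u -> ~~ hub v -> same u c -> same v d -> ~~ adj G u v.
      move=> hu hv uc vd; apply/negP => uv; apply: cd; apply: Qs => //.
      apply: (@same_trans c u d) => //; [exact: Qn|exact: Qn|by rewrite same_sym|].
      by apply: (@same_trans u v d) => //; [exact: Qn|rewrite /same uv orbT].
    by rewrite /anti !key.
  - move=> c /FP[[cQ cy cz] [[n1 n2] [s1 s2] _ [a1 a2]]].
    have key u v : ~~ hub u -> ~~ hub v -> same u c -> ~~ same c v -> ~~ adj G v u.
      move=> hu hv uc; apply: contraNN => uv; apply: (@same_trans c u v) => //; first exact: Qn.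
        by rewrite same_sym.
      by rewrite /same sym uv orbT.
    by rewrite /far a1 a2 !key.
have one v : ~~ hub v -> #|[set c in Q | same c v]| <= 1.
  move=> nv; apply/card_le1_eqP => c d; rewrite !inE => /andP[cQ cv] /andP[dQ dv].
  apply: Qs => //; apply: (@same_trans d v c) => //; [exact: Qn|exact: Qn|].
  by rewrite same_sym.
have : #|[set c in Q | ~~ good h c]| <= #|J| + #|[set c in Q | same c y]| + #|[set c in Q | same c z]|.
  apply: leq_trans (leq_trans (leq_card_setU _ _) (leq_add (leq_card_setU _ _) (leqnn _))).
  apply: subset_leq_card; apply/subsetP => c; rewrite !inE => /andP[-> ->] /=.
  by case: (same c y) => //=; case: (same c z).
by move: JF (one _ ny) (one _ nz); clear; lia.
Qed.

(* If every hub has two neighbours in D, a vertex of D adjacent to a hub is within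
   distance two of another vertex of D. *)
Lemma sds_criterion (D : {set G}) :
  (forall z u, hub z -> exists2 d, d \in D & (d != u) && adj G z d) ->
  (forall v, ~~ hub v -> v \notin D -> exists2 d, d \in D & adj G v d) ->
  (forall u, ~~ hub u -> u \in D -> (exists2 z, hub z & adj G u z) \/
     exists2 t, t \in D & (t != u) && within2 u t) ->
  semitotal_dom D.
Proof.
move=> ha hb hc; split=> [x xD|u uD].
  have [hx|hx] := boolP (hub x); last exact: hb.
  by have [d dD /andP[_ h]] := ha x x hx; exists d.
have [hu|hu] := boolP (hub u).
  by have [d dD /andP[du h]] := ha u u hu; exists d => //; rewrite du /within2 h.
have [[z hz uz]|//] := hc u hu uD.
have [d dD /andP[du h]] := ha z u hz; exists d => //.
by rewrite du /within2; apply/orP; right; apply/existsP; exists z; rewrite uz.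
Qed.

(** * Exchange arguments inside a union of cliques *)

Definition region (Q : {set G}) := [set u | ~~ hub u & [exists c in Q, same u c]].

Lemma region_closed Q u v : reps Q -> u \in region Q -> ~~ hub v -> adj G u v -> v \in region Q.
Proof.
move=> [Qn _]; rewrite !inE => /andP[hu /existsP[c /andP[cQ uc]]] hv uv.
rewrite hv; apply/existsP; exists c; rewrite cQ; apply: (@same_trans v u c) => //; first exact: Qn.
by rewrite /same sym uv orbT.
Qed.

(** Non-hubs outside the region have no non-hub neighbour inside it, so they keep their dominators.
    A witness lost to the region was reached through a hub, and [E] supplies that hub with a
    neighbour different from any given vertex. *)
Lemma sds_replace (D E : {set G}) Q : reps Q -> semitotal_dom D ->
  (forall z u, hub z -> exists2 d, d \in E & (d != u) && adj G z d) ->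
  (forall v, v \in region Q -> v \notin E -> exists2 d, d \in E & adj G v d) ->
  (forall u, ~~ hub u -> u \in E -> (exists2 z, hub z & adj G u z) \/
     exists2 t, t \in E & (t != u) && within2 u t) ->
  semitotal_dom ((D :\: region Q) :|: E).
Proof.
move=> rQ [dom sem] ha hb hc; apply: sds_criterion.
- by move=> z u /(ha z u)[d dE h]; exists d => //; rewrite inE dE orbT.
- move=> v hv; rewrite in_setU in_setD negb_or negb_and negbK => /andP[+ vE].
  have [vP _|vP /=] := boolP (v \in region Q).
    by have [d dE h] := hb v vP vE; exists d => //; rewrite inE dE orbT.
  move=> /dom[y yD vy]; exists y => //; rewrite in_setU in_setD yD andbT.
  by rewrite (contraNN _ vP) // => yP; apply: region_closed yP hv _; rewrite // sym.
- move=> u hu; rewrite in_setU in_setD => /orP[/andP[uP uD]|uE]; last first.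
    case: (hc u hu uE) => [|[t tE h]]; [by left|right].
    by exists t => //; rewrite inE tE orbT.
  have [t tD /andP[tu ut]] := sem u uD.
  have [tP|tP] := boolP (t \in region Q); last first.
    by right; exists t; [rewrite in_setU in_setD tP tD|rewrite tu].
  case/orP: ut => [ut|/existsP[z /andP[uz zt]]].
    by case/negP: uP; apply: region_closed tP hu _; rewrite // sym.
  have [hz|hz] := boolP (hub z); first by left; exists z.
  case/negP: uP; apply: (@region_closed Q z u) => //; last by rewrite sym.
  by apply: region_closed tP hz _; rewrite // sym.
Qed.

(** The cliques of [Q] are disjoint and each contains an element of [D], so deleting the region
    removes at least [#|Q|] elements. *)
Lemma hit_card (D : {set G}) Q : reps Q ->
  {in Q, forall c, exists2 d, d \in D & ~~ hub d && same d c} ->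
  #|D :\: region Q| + #|Q| <= #|D|.
Proof.
move=> [Qn Qs] hit.
pose d c := if [pick d in D | ~~ hub d && same d c] is Some d then d else c.
have dP c : c \in Q -> [/\ d c \in D, ~~ hub (d c) & same (d c) c].
  move=> cQ; rewrite /d; case: pickP => [x /andP[xD /andP[h1 h2]] //|no].
  by have [x xD h] := hit c cQ; have := no x; rewrite /= xD h.
rewrite -(cardsID (region Q) D) addnC leq_add2r.
have inj : {in Q &, injective d}.
  move=> c c' cQ c'Q E; have [_ h1 h2] := dP c cQ; have [_ _ h3] := dP c' c'Q.
  apply: Qs => //; apply: (@same_trans c (d c) c') => //; [exact: Qn|exact: Qn|by rewrite same_sym|].
  by rewrite E.
rewrite -(card_in_imset inj); apply: subset_leq_card; apply/subsetP => _ /imsetP[c cQ ->].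
have [h1 h2 h3] := dP c cQ; rewrite !inE h1 h2 /=; apply/existsP; exists c; by rewrite cQ.
Qed.

Lemma legs_reps (I : {set 'I_w}) : reps [set (M i).1 | i in I].
Proof.
split=> [_ /imsetP[i _ ->]|_ _ /imsetP[i _ ->] /imsetP[j _ ->] h].
  by have [] := leg_nonhub i.
by rewrite (@touch_leg i j) // /touch; case/orP: h => ->; rewrite ?orbT.
Qed.

Lemma leg_inj : injective (fun i => (M i).1).
Proof. by move=> i j E; apply: touch_leg; rewrite /touch E eqxx. Qed.

Lemma leg_pair i : [/\ ~~ hub (M i).1, ~~ hub (M i).2, same (M i).1 (M i).1, same (M i).2 (M i).1
  & (M i).1 != (M i).2].
Proof.
have [n1 n2] := leg_nonhub i; have [he _] := matM; split=> //; rewrite /same ?eqxx //.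
  by rewrite sym he orbT.
by apply: contraTneq (he i) => <-; rewrite irr.
Qed.

Lemma bad_legs h (I : {set 'I_w}) : hub h -> #|[set i in I | ~~ good h (M i).1]| <= k.+1.
Proof.
move=> hh; have := bad_bound hh (legs_reps I); apply: leq_trans.
rewrite -(card_in_imset (in2W leg_inj)); apply: subset_leq_card.
apply/subsetP => _ /imsetP[i + ->]; rewrite !inE => /andP[iI ->]; rewrite andbT.
exact: (imset_f (fun i => (M i).1)).
Qed.

(** At most [k + 1] of the edges are bad for [z], so two others remain. Each of these has a leg
    adjacent to [z], and one of the two legs found avoids [u]. *)
Lemma hub_two_nbrs z u (I : {set 'I_w}) : hub z -> k + 3 <= #|I| ->
  exists i d, [/\ i \in I, d = (M i).1 \/ d = (M i).2, d != u & adj G z d].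
Proof.
move=> hz cI; have := bad_legs I hz.
have := cardsID [set i | good z (M i).1] I.
have -> : I :\: [set i | good z (M i).1] = [set i in I | ~~ good z (M i).1].
  by apply/setP => i; rewrite !inE andbC.
set X := #|_ :&: _|; set Y := #|_|; move=> E1 E2.
have : 1 < X by move: cI E2; rewrite -E1; clear; lia.
case/card_gt1P=> i [j []]; rewrite !inE => /andP[iI gi] /andP[jI gj] ij.
have nbr l : good z (M l).1 -> exists2 d, d = (M l).1 \/ d = (M l).2 & adj G z d.
  move=> gl; have [h1 h2 h3 h4 h5] := leg_pair l.
  have [a1|a1] := boolP (adj G z (M l).1); first by exists (M l).1; auto.
  by exists (M l).2; [right|apply: goodP gl h1 h2 h3 h4 h5 a1].
have [di ei ai] := nbr i gi; have [dj ej aj] := nbr j gj.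
have [E|ne] := eqVneq di u; last by exists i, di.
exists j, dj; split=> //; rewrite -E; apply: contraNneq ij => E'.
apply/eqP; apply: touch_leg; rewrite /touch.
by case: ei ej E' => -> [] -> ->; rewrite eqxx ?orbT.
Qed.

(** On the cliques of [I], the set [D] could be replaced by [g], [h] and both legs of [k + 3] edges,
    which give every hub two neighbours. These are [2 + 2 * (k + 3) = 2 * k + 8] vertices, so
    minimality of [D] bounds [I]. *)
Lemma two_hubs (D : {set G}) g h (I : {set 'I_w}) : min_sds D -> hub g -> hub h ->
  {in I, forall i, exists2 d, d \in D & ~~ hub d && same d (M i).1} ->
  {in I, forall i v, ~~ hub v -> same v (M i).1 -> adj G g v || adj G h v} ->
  #|I| <= 2 * k + 8.
Proof.
move=> [sD minD] hg hh hit dom; rewrite leqNgt; apply/negP => cI.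
have [I3 [sub3 c3]] : exists I3 : {set 'I_w}, I3 \subset I /\ #|I3| = k + 3.
  by apply: subset_card; lia.
pose Q := [set (M i).1 | i in I].
pose E := [set g; h] :|: ([set (M i).1 | i in I3] :|: [set (M i).2 | i in I3]).
have cQ : #|Q| = #|I| by rewrite card_imset //; apply: leg_inj.
have cE : #|E| <= 2 * k + 8.
  apply: leq_trans (leq_card_setU _ _) _; rewrite cards2.
  have : #|[set (M i).1 | i in I3] :|: [set (M i).2 | i in I3]| <= (k + 3) + (k + 3).
    by apply: leq_trans (leq_card_setU _ _) _; apply: leq_add; rewrite -c3; apply: leq_imset_card.
  by case: (g != h) => /=; move: #|_ :|: _|; clear; lia.
have sD' : semitotal_dom ((D :\: region Q) :|: E).
  apply: sds_replace => //; first exact: legs_reps.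
  - move=> z u hz; have [i [d [iI ed du zd]]] : exists i d, [/\ i \in I3, d = (M i).1 \/ d = (M i).2, d != u & adj G z d].
      by apply: hub_two_nbrs; rewrite ?c3.
    exists d; last by rewrite du.
    rewrite !inE; case: ed => ->; first by rewrite (imset_f (fun i => (M i).1)) // orbT.
    by rewrite (imset_f (fun i => (M i).2)) // !orbT.
  - move=> v; rewrite inE => /andP[hv /existsP[_ /andP[/imsetP[i iI ->] vi]]] _.
    case/orP: (dom i iI v hv vi) => h'; [exists g|exists h]; rewrite ?(sym v) // !inE eqxx ?orbT //.
  - move=> u hu; rewrite !inE => /orP[/orP[/eqP E'|/eqP E']|uI]; [by rewrite E' hg in hu|by rewrite E' hh in hu|].
    have [he _] := matM.
    right; case/orP: uI => /imsetP[i iI ->]; have [_ _ _ _ ne] := leg_pair i.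
      exists (M i).2; last by rewrite eq_sym ne /within2 he.
      by rewrite !inE (imset_f (fun i => (M i).2)) // !orbT.
    exists (M i).1; last by rewrite ne /within2 sym he.
    by rewrite !inE (imset_f (fun i => (M i).1)) // !orbT.
have h1 := leq_trans (minD _ sD') (leq_card_setU (D :\: region Q) E).
have h2 : #|D :\: region Q| + #|I| <= #|D|.
  by rewrite -cQ; apply: hit_card; [apply: legs_reps|move=> _ /imsetP[i iI ->]; apply: hit].
have arith d x e i K : d <= x + e -> x + i <= d -> e <= K -> K < i -> False by clear; lia.
exact: arith h1 h2 cE cI.
Qed.

(** The cliques of [J] pay for the hubs of [Hs]. On further matching cliques, good for a hub [h] of
    [Hs], the elements of [D] are exchanged for legs adjacent to [h]. The size does not grow, and
    [h] with two such legs is a friendly triple. *)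
Lemma swap_reducible (D Hs J : {set G}) : 8 * k + 20 <= w -> min_sds D ->
  (forall i, exists2 d, d \in D & ~~ hub d && same d (M i).1) ->
  (exists h, h \in Hs) -> {in Hs, forall h, hub h} -> reps J ->
  {in J, forall c, exists2 d, d \in D & ~~ hub d && same d c} ->
  {in J, forall c v, ~~ hub v -> same v c -> exists2 h, h \in Hs & adj G h v} ->
  #|Hs :\: D| <= #|J| -> #|J| <= 3 * k + 4 -> reducible G.
Proof.
move=> hw' minD hit [h hH] Hub rJ hitJ domJ cH cJ; have hh := Hub h hH.
pose I := [set i | good h (M i).1 & [forall c in J, ~~ same c (M i).1]].
have cI : w - (k + 1) - #|J| <= #|I|.
  have : #|~: I| <= k.+1 + #|J|.
    apply: leq_trans (_ : #|[set i in [set: 'I_w] | ~~ good h (M i).1] :|: [set i | [exists c in J, same c (M i).1]]| <= _).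
      apply: subset_leq_card; apply/subsetP => i; rewrite !inE negb_and /=; case/orP=> [->//|].
      by rewrite negb_forall_in => /existsP[c /andP[cJ' h']]; apply/orP; right; apply/existsP; exists c; rewrite cJ' -[same _ _]negbK.
    apply: leq_trans (leq_card_setU _ _) _; apply: leq_add; first exact: bad_legs.
    pose r i := if [pick c in J | same c (M i).1] is Some c then c else (M i).1.
    have rP i : i \in [set i | [exists c in J, same c (M i).1]] -> r i \in J /\ same (r i) (M i).1.
      rewrite inE => /existsP[c hc]; rewrite /r; case: pickP => [x /andP[]//|/(_ c)].
      by rewrite /= hc.
    rewrite -(@card_in_imset _ _ r).
      by apply: subset_leq_card; apply/subsetP => _ /imsetP[i /rP[ri _] ->].
    move=> i j /rP[riJ ri] /rP[rjJ rj] E; apply: leg_inj.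
    have [n1 _] := leg_nonhub i; have [n2 _] := leg_nonhub j; have [Jn _] := rJ.
    have [_] := legs_reps setT; apply; try exact: (imset_f (fun i => (M i).1)).
    apply: (@same_trans _ (r i) _) => //; [exact: Jn|by rewrite same_sym|by rewrite E].
  move=> h1; have := cardsC I; rewrite card_ord => h2.
  have arith a b c d : c <= d + a -> b + c = w -> w - d - a <= b by clear; lia.
  by rewrite addn1; apply: arith h1 h2.
have JI c i : c \in J -> i \in I -> ~~ same c (M i).1.
  by move=> cJ' ; rewrite inE => /andP[_ /forallP/(_ c)]; rewrite cJ'.
have gI i : i \in I -> good h (M i).1 by rewrite inE => /andP[].
clearbody I.
pose e i := if adj G h (M i).1 then (M i).1 else (M i).2.
have eP i : i \in I -> [/\ adj G h (e i), ~~ hub (e i) & same (e i) (M i).1].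
  move=> /gI gi; have [h1 h2 h3 h4 h5] := leg_pair i; rewrite /e.
  case: ifP => [a1|/negbT a1] //; split=> //; exact: goodP gi h1 h2 h3 h4 h5 a1.
have eE i j : e i = e j -> i = j.
  move=> E; apply: touch_leg; move: E; rewrite /touch /e.
  by case: ifP => _; case: ifP => _ ->; rewrite eqxx ?orbT.
pose Q := J :|: [set (M i).1 | i in I].
have rQ : reps Q.
  have [Jn Js] := rJ; have [In Is] := legs_reps I.
  split=> [c|c d]; first by rewrite in_setU => /orP[/Jn|/In].
  rewrite !in_setU => /orP[cJ'|cI'] /orP[dJ|dI]; [exact: Js| | |exact: Is].
    by case/imsetP: dI => i iI -> h'; have := JI c i cJ' iI; rewrite h'.
  by case/imsetP: cI' => i iI ->; rewrite same_sym => h'; have := JI d i dJ iI; rewrite h'.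
have cQ : #|Q| = #|J| + #|I|.
  rewrite cardsU (_ : J :&: _ = set0) ?cards0 ?subn0 ?card_imset //; first exact: leg_inj.
  apply/setP => c; rewrite in_set0 inE; apply/negP => /andP[cJ' /imsetP[i iI E]].
  by have := JI c i cJ' iI; rewrite E /same eqxx.
pose E := Hs :|: [set e i | i in I].
have eIE i : i \in I -> e i \in E by move=> iI; rewrite inE imset_f ?orbT.
have hE : h \in E by rewrite inE hH.
pose D' := (D :\: region Q) :|: E.
have sD' : semitotal_dom D'.
  apply: sds_replace => //; first by case: minD.
  - move=> z u hz.
    have [|few] := ltnP 1 #|[set i in I | adj G z (e i)]|.
      case/card_gt1P=> i [j []]; rewrite !inE => /andP[iI ai] /andP[jI aj] ij.
      have [E1|ne] := eqVneq (e i) u; last by exists (e i); [exact: eIE|rewrite ne].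
      exists (e j); [exact: eIE|rewrite aj andbT -E1].
      by apply: contraNneq ij => /eE ->.
    (* If [z] misses [e i] in a clique good for [z], it misses nothing else there, and [h] covers
       [e i]. So [z] and [h] together dominate these cliques, and [two_hubs] limits their number. *)
    pose I2 := [set i in I | good z (M i).1 & ~~ adj G z (e i)].
    have : #|I2| <= 2 * k + 8.
      apply: (two_hubs minD hz hh); first by move=> i _; apply: hit.
      move=> i; rewrite inE => /andP[iI /andP[gi ai]] v hv vi.
      have [h1 h2 h3] := eP i iI; have [->|ne] := eqVneq v (e i); first by rewrite h1 orbT.
      by apply/orP; left; apply: (goodP gi h2 hv h3 vi _ ai); rewrite eq_sym.
    have : #|I| <= #|I2| + #|[set i in I | adj G z (e i)]| + #|[set i in I | ~~ good z (M i).1]|.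
      apply: leq_trans (leq_trans (leq_card_setU _ _) (leq_add (leq_card_setU _ _) (leqnn _))).
      apply: subset_leq_card; apply/subsetP => i iI; rewrite !inE iI /=.
      by case: (good _ _); case: (adj G z _).
    move=> h1 h2.
    (* At least [4k + 15] indices remain in [I], while the three classes hold at most
       [(2k + 8) + 1 + (k + 1) = 3k + 10]. *)
    have arith a b c d f : a <= b + c + d -> b <= 2 * k + 8 -> c <= 1 -> d <= k.+1 ->
      w - (k + 1) - f <= a -> f <= 3 * k + 4 -> 8 * k + 20 <= w -> False by clear; lia.
    by case: (arith _ _ _ _ _ h1 h2 few (bad_legs I hz) cI cJ hw').
  - move=> v; rewrite inE => /andP[hv /existsP[c /andP[]]]; rewrite in_setU => /orP[cJ' vc|/imsetP[i iI ->] vi] vE.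
      by have [x xH xv] := domJ c cJ' v hv vc; exists x; rewrite ?inE ?xH // sym.
    exists (e i); first exact: eIE.
    have [h1 h2 h3] := eP i iI; have [n1 _] := leg_nonhub i; apply: same_adj vi h3 _ => //.
    by apply: contraNneq vE => ->; apply: eIE.
  - move=> u hu; rewrite in_setU => /orP[/Hub|/imsetP[i iI ->]]; first by rewrite (negbTE hu).
    by left; exists h => //; rewrite sym; case: (eP i iI).
have cD' : #|D'| <= #|D|.
  (* Hubs of [Hs] already in [D] lie outside the region and survive, so only [Hs :\: D] counts as
     new. *)
  have s1 : D' \subset (D :\: region Q) :|: ((Hs :\: D) :|: [set e i | i in I]).
    apply/subsetP => x; rewrite !in_setU !in_setD => /orP[->//|/orP[xH|->]]; last by rewrite !orbT.
    by rewrite xH inE (Hub x xH) /=; case: (x \in D); rewrite ?orbT.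
  have h1 := leq_trans (subset_leq_card s1) (leq_card_setU _ _).
  have h2 := leq_card_setU (Hs :\: D) [set e i | i in I].
  have h3 := leq_imset_card e I.
  have h4 : #|D :\: region Q| + (#|J| + #|I|) <= #|D|.
    rewrite -cQ; apply: hit_card => // c; rewrite in_setU => /orP[/hitJ//|/imsetP[i iI ->]].
    exact: hit.
  have arith a b c d f g i j : a <= b + c -> c <= d + f -> f <= g -> b + (i + g) <= j -> d <= i ->
    a <= j by clear; lia.
  exact: arith h1 h2 h3 h4 cH.
exists D'.
  by case: minD => sD minD; split=> // D0 /minD; apply: leq_trans.
have arith a b : w - (k + 1) - a <= b -> a <= 3 * k + 4 -> 8 * k + 20 <= w -> 1 < b by clear; lia.
have : 1 < #|I| by exact: arith cI cJ hw'.
case/card_gt1P=> i [j [iI jI ij]]; have [ai _ _] := eP i iI; have [aj _ _] := eP j jI.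
have inD' x : x \in E -> x \in D' by move=> xE; rewrite /D' in_setU xE orbT.
exists (e i), h, (e j); split; rewrite ?inD' ?eIE //; first by rewrite sym.
split; first by apply: contraNneq ij => /eE ->.
  by apply: contraTneq aj => ->; rewrite irr.
by rewrite /within2 aj.
Qed.

(** With [J] empty, a single hub in [D] already allows the swap, so [D] is hub-free and, being
    dominating, hits every clique. A trade is then a swap with [J] the traded cliques. *)
Lemma irreducible_no_trade (D : {set G}) : 8 * k + 20 <= w -> ~ reducible G -> min_sds D ->
  (forall i, (M i).1 \in D) -> no_trade (3 * k + 4).
Proof.
move=> hw' nred minD hD.
have hit i : exists2 d, d \in D & ~~ hub d && same d (M i).1.
  by have [h1 _ h3 _ _] := leg_pair i; exists (M i).1; rewrite ?h1.
have noH h : h \in D -> ~~ hub h.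
  move=> hD'; apply/negP => hh; apply: nred.
  apply: (@swap_reducible D [set h] set0) => //.
  - by exists h; rewrite set11.
  - by move=> x /set1P->.
  - by split=> [c|c d]; rewrite inE.
  - by move=> c; rewrite inE.
  - by move=> c; rewrite inE.
  - by rewrite cards0 (_ : _ :\: _ = set0) ?cards0 //; apply/eqP; rewrite setD_eq0 sub1set.
  - by rewrite cards0.
move=> r [hs [cs [hsP [csP [csI dom]]]]]; apply: nred.
have [sD _] := minD; have [domD _] := sD.
pose J := [set cs j | j in 'I_r.+1].
have cs_inj : injective cs.
  by move=> i j E; apply/eqP; apply: contraT => /csI; rewrite E /same eqxx.
have cJ : #|J| = r.+1 by rewrite card_imset // card_ord.
apply: (@swap_reducible D [set hs j | j in 'I_r.+1] J) => //.
- by exists (hs ord0); apply: imset_f.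
- by move=> _ /imsetP[j _ ->].
- split=> [_ /imsetP[j _ ->]//|_ _ /imsetP[i _ ->] /imsetP[j _ ->] h].
  by congr cs; apply/eqP; apply: contraTT h => /csI.
- move=> _ /imsetP[j _ ->]; have [cD|cD] := boolP (cs j \in D).
    by exists (cs j) => //; rewrite csP /same eqxx.
  by have [y yD cy] := domD _ cD; exists y => //; rewrite noH //= /same sym cy orbT.
- move=> _ /imsetP[i _ ->] v hv vi; have [j hj] := dom i v hv vi.
  by exists (hs j) => //; apply: imset_f.
- rewrite cJ; apply: leq_trans (subset_leq_card (subsetDl _ _)) _.
  by apply: leq_trans (leq_imset_card _ _) _; rewrite card_ord.
- by rewrite cJ; have := ltn_ord r; lia.
Qed.

(** * Excluding small trades excludes all trades *)

Definition fully_dominated (Hs : {set G}) (c : G) :=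
  [forall v, ~~ hub v && same v c ==> [exists h in Hs, adj G h v]].

Lemma fully_dominatedP (Hs : {set G}) (c : G) :
  reflect (forall v, ~~ hub v -> same v c -> exists2 h, h \in Hs & adj G h v) (fully_dominated Hs c).
Proof.
apply: (iffP forallP) => [h v hv vc|h v].
  by have /implyP := h v; rewrite hv vc => /(_ isT) /existsP[x /andP[]]; exists x.
apply/implyP => /andP[hv vc]; have [x xH xv] := h v hv vc.
by apply/existsP; exists x; rewrite xH.
Qed.

(** Set form of [no_trade], where the ordinal [r] stands for [r + 1] hubs. *)
Lemma no_trade_small q (Hs J : {set G}) : no_trade q -> #|Hs| <= q -> Hs != set0 ->
  {in Hs, forall h, hub h} -> reps J -> {in J, forall c, fully_dominated Hs c} -> #|J| < #|Hs|.
Proof.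
move=> nt cH H0 Hub [Jn Js] dom; rewrite ltnNge; apply/negP => cJ.
have {}H0 : 0 < #|Hs| by rewrite card_gt0.
have hr : #|Hs|.-1 < q by rewrite prednK.
have er : (Ordinal hr).+1 = #|Hs| by rewrite /= prednK.
have er' : (Ordinal hr).+1 <= #|J| by rewrite er.
apply: (nt (Ordinal hr)).
exists (fun j => enum_val (cast_ord er j)), (fun j => enum_val (widen_ord er' j)); split; last split; last split.
- by move=> j; apply: Hub; apply: enum_valP.
- by move=> j; apply: Jn; apply: enum_valP.
- move=> i j; apply: contraNN => /(Js _ _ (enum_valP _) (enum_valP _)) /enum_val_inj E.
  by apply/eqP; apply: val_inj; case: E.
- move=> i y hy yi; have /fully_dominatedP/(_ y hy yi)[h hH ha] := dom _ (enum_valP (widen_ord er' i)).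
  exists (cast_ord (esym er) (enum_rank_in hH h)).
  by rewrite cast_ordKV enum_rankK_in.
Qed.

Lemma pair_reps c d : ~~ hub c -> ~~ hub d -> ~~ same c d -> reps [set c; d].
Proof.
move=> hc hd cd; split=> [x|x y]; first by rewrite !inE => /orP[]/eqP->.
rewrite !inE => /orP[]/eqP-> /orP[]/eqP-> //; first by rewrite (negbTE cd).
by rewrite same_sym (negbTE cd).
Qed.

Lemma no_trade_one q h c : no_trade q -> 0 < q -> hub h -> ~~ hub c ->
  exists v, [/\ ~~ hub v, same v c & ~~ adj G h v].
Proof.
move=> nt q0 hh hc; apply: NNPP => no.
have : #|[set c]| < #|[set h]|; last by rewrite !cards1.
apply: (no_trade_small nt); rewrite ?cards1 //.
- by apply/set0Pn; exists h; rewrite set11.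
- by move=> _ /set1P->.
- by split=> [_ /set1P->//|_ _ /set1P-> /set1P->].
- move=> _ /set1P->; apply/fully_dominatedP => v hv vc; exists h; first by rewrite set11.
  by apply: contraT => hva; case: no; exists v.
Qed.

Lemma no_trade_two q g h c d : no_trade q -> 1 < q -> hub g -> hub h -> ~~ hub c -> ~~ hub d ->
  ~~ same c d -> fully_dominated [set g; h] c -> ~~ fully_dominated [set g; h] d.
Proof.
move=> nt q1 hg hh hc hd cd fc; apply/negP => fd.
have cH : #|[set g; h]| <= 2 by rewrite cards2; case: (g != h).
have ne : c != d by apply: contraNneq cd => ->; rewrite /same eqxx.
have : #|[set c; d]| < #|[set g; h]|; last by rewrite cards2 ne ltnNge cH.
apply: (no_trade_small nt) => //; first exact: leq_trans cH q1.
- by apply/set0Pn; exists g; rewrite set21.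
- by move=> x; rewrite !inE => /orP[]/eqP->.
- exact: pair_reps.
- by move=> x; rewrite !inE => /orP[]/eqP->.
Qed.

Lemma good_pair_dominated g h c m : good h c -> ~~ hub c -> ~~ hub m -> same m c ->
  ~~ adj G h m -> adj G g m -> fully_dominated [set g; h] c.
Proof.
move=> gd hc hm mc nm gm; apply/fully_dominatedP => v hv vc.
have [->|ne] := eqVneq v m; first by exists g; rewrite ?set21.
by exists h; [rewrite set22|apply: goodP gd hm hv mc vc _ nm; rewrite eq_sym].
Qed.

Lemma no_trade_all (Hs J : {set G}) : no_trade (3 * k + 4) -> Hs != set0 ->
  {in Hs, forall h, hub h} -> reps J -> {in J, forall c, fully_dominated Hs c} -> #|J| < #|Hs|.
Proof.
move=> nt H0 Hub rJ dom.
have [|big] := leqP #|Hs| (3 * k + 4); first by move=> cH; apply: no_trade_small nt _ _ _ _ _.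
rewrite ltnNge; apply/negP => cJ; have [Jn Js] := rJ.
have q0 : 0 < 3 * k + 4 by clear; lia.
have q1 : 1 < 3 * k + 4 by clear; lia.
have [h0 h0H] : exists h0, h0 \in Hs by apply/set0Pn.
have hh0 := Hub h0 h0H.
pose J0 := [set c in J | good h0 c].
have J0P c : c \in J0 -> [/\ c \in J, ~~ hub c & good h0 c].
  by rewrite inE => /andP[cJ' g]; split=> //; apply: Jn.
have cJ0 : 2 * k + 4 <= #|J0|.
  have h1 := bad_bound hh0 rJ; have h2 := cardsID [set c | good h0 c] J.
  have E1 : J :&: [set c | good h0 c] = J0 by apply/setP => c; rewrite !inE.
  have E2 : J :\: [set c | good h0 c] = [set c in J | ~~ good h0 c] by apply/setP => c; rewrite !inE andbC.
  rewrite E1 E2 in h2.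
  have arith a b x y : a + b = x -> b <= k.+1 -> y <= x -> 3 * k + 4 < y -> 2 * k + 4 <= a by clear; lia.
  exact: arith h2 h1 cJ big.
(* [f c] pairs the one vertex of the clique missed by [h0] with a hub of [Hs] that covers it. *)
pose P c (x : G * G) := [&& ~~ hub x.1, same x.1 c, ~~ adj G h0 x.1, x.2 \in Hs & adj G x.2 x.1].
pose f c := if [pick x | P c x] is Some x then x else (c, c).
have fP c : c \in J0 -> P c (f c).
  case/J0P=> cJ' hc gc; rewrite /f; case: pickP => // no.
  have [v [hv vc nv]] := no_trade_one nt q0 hh0 hc.
  have /fully_dominatedP/(_ v hv vc)[x xH xv] := dom c cJ'.
  by have := no (v, x); rewrite /P /= hv vc nv xH xv.
pose m c := (f c).1; pose a c := (f c).2.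
have mP c : c \in J0 -> [/\ ~~ hub (m c), same (m c) c, ~~ adj G h0 (m c), hub (a c) & adj G (a c) (m c)].
  by move=> /fP /and5P[h1 h2 h3 h4 h5]; split=> //; apply: Hub.
have h0a c : c \in J0 -> fully_dominated [set a c; h0] c.
  move=> cJ'; have [h1 h2 h3 h4 h5] := mP c cJ'; have [_ hc gc] := J0P c cJ'.
  exact: good_pair_dominated gc hc h1 h2 h3 h5.
have J0s c d : c \in J0 -> d \in J0 -> c != d -> ~~ same c d.
  by case/J0P=> cJ' _ _ /J0P[dJ _ _]; apply: contraNN => /(Js _ _ cJ' dJ) ->.
(* If [a d] were adjacent to [m c], then [a d] and [h0] would dominate both cliques. So [m c] is the
   only vertex that [a d] misses, and [a c] covers it. *)
have half c d : c \in J0 -> d \in J0 -> c != d -> good (a d) c -> fully_dominated [set a c; a d] c.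
  move=> cJ' dJ cd g; have [h1 h2 h3 h4 h5] := mP c cJ'; have [_ hc gc] := J0P c cJ'.
  have [_ _ _ had _] := mP d dJ; have [_ hd gd] := J0P d dJ.
  apply: (good_pair_dominated g hc h1 h2 _ h5); apply/negP => adm.
  have := no_trade_two nt q1 had hh0 hd hc _ (h0a d dJ); rewrite (good_pair_dominated gc hc h1 h2 h3 adm).
  by move=> /(_ _)/negP; apply => //; apply: J0s; rewrite // eq_sym.
have bad2 c d : c \in J0 -> d \in J0 -> c != d -> ~~ good (a d) c || ~~ good (a c) d.
  move=> cJ' dJ cd; rewrite -negb_and; apply/negP => /andP[g1 g2].
  have [_ _ _ hac _] := mP c cJ'; have [_ _ _ had _] := mP d dJ.
  have [_ hc _] := J0P c cJ'; have [_ hd _] := J0P d dJ.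
  have := no_trade_two nt q1 hac had hc hd (J0s _ _ cJ' dJ cd) (half c d cJ' dJ cd g1).
  by rewrite setUC half // eq_sym.
have rJ0 : reps J0.
  by split=> [c /J0P[]|c d /J0P[h1 _ _] /J0P[h2 _ _]] //; apply: Js.
have s1 : \sum_(c in J0) #|J0 :\ c| = #|J0| * #|J0|.-1.
  rewrite -sum_nat_const; apply: eq_bigr => c cJ'; by rewrite (cardsD1 c J0) cJ'.
have cardE (A : pred G) : #|[set d in J0 | A d]| = \sum_(d in J0) A d.
  by rewrite -sum1dep_card big_mkcondr /=; apply: eq_bigr => d _; case: (A d).
have s2 : \sum_(c in J0) #|[set d in J0 | ~~ good (a c) d]| <= #|J0| * k.+1.
  rewrite -sum_nat_const; apply: leq_sum => c cJ'; apply: bad_bound => //.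
  by have [] := mP c cJ'.
(* Exchanging the sums lets the bound on bad cliques per hub control both kinds of bad pairs. *)
have s3 : \sum_(c in J0) #|[set d in J0 | ~~ good (a d) c]| = \sum_(c in J0) #|[set d in J0 | ~~ good (a c) d]|.
  under eq_bigr do rewrite cardE.
  under [RHS]eq_bigr do rewrite cardE.
  exact: exchange_big.
have : #|J0| * #|J0|.-1 <= #|J0| * k.+1 + #|J0| * k.+1.
  apply: leq_trans (_ : _ <= \sum_(c in J0) (#|[set d in J0 | ~~ good (a d) c]| + #|[set d in J0 | ~~ good (a c) d]|)) _.
    rewrite -s1; apply: leq_sum => c cJ'; apply: leq_trans (leq_card_setU _ _).
    apply: subset_leq_card; apply/subsetP => d; rewrite in_setD1 => /andP[dc dJ].
    rewrite in_setU [d \in [set _ in _ | _]]inE [d \in [set d0 in J0 | ~~ good (a c) d0]]inE dJ /=.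
    by apply: bad2; rewrite // eq_sym.
  by rewrite big_split /= s3; apply: leq_add.
rewrite -mulnDr leq_pmul2l; last by apply: leq_trans cJ0; rewrite addnS.
have arith x : 2 * k + 4 <= x -> x.-1 <= k.+1 + k.+1 -> False by clear; lia.
exact: arith cJ0.
Qed.

(** * Hub-free transversals of the cliques *)

Hypothesis conn : connected_graph G.

(** A clique without an edge to a hub would be a component, hence all of [G] by connectivity; but
    two matching edges lie in different cliques. *)
Lemma clique_exit c : ~~ hub c -> exists u z, [/\ ~~ hub u, same u c, hub z & adj G u z].
Proof.
move=> hc; apply: NNPP => no.
have closed y : connect (adj G) c y -> ~~ hub y /\ same y c.
  case/connectP=> p pth ->; elim/last_ind: p pth => [|p y' IH]; first by rewrite /same eqxx.
  rewrite rcons_path last_rcons => /andP[/IH[h1 h2] hl].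
  have hy : ~~ hub y' by apply/negP => hy; apply: no; exists (last c p), y'.
  split=> //; apply: (@same_trans _ (last c p)) => //.
  by rewrite /same sym hl orbT.
have w1 : 1 < w by move: hw; clear; lia.
pose i0 : 'I_w := Ordinal (ltnW w1); pose i1 : 'I_w := Ordinal w1.
have [h1 s1] := closed (M i0).1 (conn _ _); have [h2 s2] := closed (M i1).1 (conn _ _).
have : i0 = i1; last by case.
have sm : same (M i0).1 (M i1).1 by apply: (@same_trans _ c) => //; rewrite same_sym.
by apply: touch_leg; rewrite /touch; case/orP: sm => ->; rewrite ?orbT.
Qed.

(** [pick] depends only on the predicate up to extensionality, so all vertices of a clique receive
    the same representative. *)
Definition clique_rep v := if [pick u | ~~ hub u && same u v] is Some u then u else v.

Definition all_reps := [set clique_rep v | v in [set v | ~~ hub v]].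

Lemma clique_repP v : ~~ hub v -> ~~ hub (clique_rep v) /\ same (clique_rep v) v.
Proof.
move=> hv; rewrite /clique_rep; case: pickP => [u /andP[]//|/(_ v)].
by rewrite hv /same eqxx.
Qed.

Lemma clique_rep_eq u v : ~~ hub u -> ~~ hub v -> same u v -> clique_rep u = clique_rep v.
Proof.
move=> hu hv uv; rewrite /clique_rep.
have /eq_pick -> : (fun t => ~~ hub t && same t u) =1 (fun t => ~~ hub t && same t v).
  move=> t; have [//|ht /=] := boolP (hub t); apply/idP/idP => h.
    exact: same_trans h uv.
  by apply: same_trans h _; rewrite // same_sym.
by case: pickP => // /(_ v); rewrite /= hv /same eqxx.
Qed.

Lemma all_reps_reps : reps all_reps.
Proof.
split=> [_ /imsetP[v + ->]|_ _ /imsetP[u + ->] /imsetP[v + ->]]; rewrite !inE.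
  by case/clique_repP.
move=> hu hv h; apply: clique_rep_eq => //.
have [h1 h2] := clique_repP hu; have [h3 h4] := clique_repP hv.
apply: (@same_trans _ (clique_rep u)) => //; first by rewrite same_sym.
exact: same_trans h h4.
Qed.

Lemma clique_rep_in v : ~~ hub v -> clique_rep v \in all_reps.
Proof. by move=> hv; apply: imset_f; rewrite inE. Qed.

Lemma card_all_reps : w <= #|all_reps|.
Proof.
rewrite -[w in w <= _]card_ord -(@card_imset _ _ (fun i => clique_rep (M i).1)).
  apply: subset_leq_card; apply/subsetP => _ /imsetP[i _ ->].
  by apply: clique_rep_in; case: (leg_nonhub i).
move=> i j E; have [hi _] := leg_nonhub i; have [hj _] := leg_nonhub j.
have [h1 h2] := clique_repP hi; have [h3 h4] := clique_repP hj.
have sm : same (M i).1 (M j).1.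
  by apply: (@same_trans _ (clique_rep (M i).1)) => //; [rewrite same_sym|rewrite E].
by apply: touch_leg; rewrite /touch; case/orP: sm => ->; rewrite ?orbT.
Qed.

(** One vertex per clique is chosen, preferably a neighbour of a fixed hub [h0]. For any hub [z], in
    all but at most [2k + 3] cliques [h0] and [z] miss the same single vertex, so the chosen vertex
    is adjacent to [z] as well. This gives every hub two neighbours. *)
Lemma no_trade_sds : 8 * k + 20 <= w -> no_trade (3 * k + 4) ->
  exists2 D : {set G}, semitotal_dom D & #|D| <= #|all_reps|.
Proof.
move=> hw' nt.
have q0 : 0 < 3 * k + 4 by clear; lia.
have [Qn Qs] := all_reps_reps.
have [h0 hh0] : exists h0, hub h0.
  have w0 : 0 < w by move: hw; clear; lia.
  have [h _] := leg_nonhub (Ordinal w0); have [u [z [_ _ hz _]]] := clique_exit h.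
  by exists z.
pose P0 c u := [&& ~~ hub u, same u c & adj G h0 u].
pose P1 c u := [&& ~~ hub u, same u c & [exists z, hub z && adj G u z]].
pose rho c := if [pick u | P0 c u] is Some u then u
  else if [pick u | P1 c u] is Some u then u else c.
have rhoP c : ~~ hub c -> [/\ ~~ hub (rho c), same (rho c) c & exists2 z, hub z & adj G (rho c) z].
  move=> hc; rewrite /rho; case: pickP => [u /and3P[h1 h2 h3]|_].
    by split=> //; exists h0; rewrite // sym.
  case: pickP => [u /and3P[h1 h2 /existsP[z /andP[h3 h4]]]|]; first by split=> //; exists z.
  have [u [z [h1 h2 h3 h4]]] := clique_exit hc => /(_ u) /negP; case; rewrite /P1 h1 h2.
  by apply/existsP; exists z; rewrite h3.
have rho_adj z c : hub z -> ~~ hub c -> good h0 c -> good z c -> ~~ fully_dominated [set z; h0] c ->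
    adj G z (rho c).
  move=> hz hc g0 gz nd; have [v [hv vc nv]] := no_trade_one nt q0 hh0 hc.
  have zv : ~~ adj G z v by apply: contraNN nd; apply: good_pair_dominated g0 hc hv vc nv.
  (* The clique has a vertex besides [v]: a singleton clique would be dominated by the hub that
     [clique_exit] provides, against [no_trade_one]. *)
  have [u [hu uc uv]] : exists u, [/\ ~~ hub u, same u c & u != v].
    apply: NNPP => no; have [u [y [hu uc hy uy]]] := clique_exit hc.
    have [t [ht tc nt']] := no_trade_one nt q0 hy hc.
    have E x : ~~ hub x -> same x c -> x = v.
      by move=> hx xc; apply/eqP; apply: contraT => xv; case: no; exists x.
    by move: nt' uy; rewrite (E t) // (E u) // sym => /negbTE ->.
  have h0u : adj G h0 u by apply: goodP g0 hv hu vc uc _ nv; rewrite eq_sym.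
  have : P0 c (rho c).
    rewrite /rho; case: pickP => // /(_ u); by rewrite /P0 hu uc h0u.
  case/and3P=> h1 h2 h3; apply: goodP gz hv h1 vc h2 _ zv.
  by apply: contraNneq nv => ->.
exists [set rho c | c in all_reps]; last exact: leq_imset_card.
apply: sds_criterion.
- move=> z u hz.
  pose T := [set c in all_reps | [&& good h0 c, good z c & ~~ fully_dominated [set z; h0] c]].
  have TP c : c \in T -> c \in all_reps /\ adj G z (rho c).
    by rewrite inE => /andP[cQ /and3P[h1 h2 h3]]; split=> //; apply: rho_adj => //; apply: Qn.
  have : 1 < #|T|.
    have b0 := bad_bound hh0 all_reps_reps; have bz := bad_bound hz all_reps_reps.
    have bd : #|[set c in all_reps | fully_dominated [set z; h0] c]| < 2.
      apply: leq_trans (_ : _ <= #|[set z; h0]|) _; last by rewrite cards2; case: (z != h0).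
      apply: no_trade_all => //.
      + by apply/set0Pn; exists z; rewrite set21.
      + by move=> x; rewrite !inE => /orP[]/eqP->.
      + by split=> [c|c d]; rewrite !inE => /andP[h _]; [exact: Qn|case/andP=> h' _; apply: Qs].
      + by move=> c; rewrite inE => /andP[].
    have un : #|all_reps| <= #|T| + #|[set c in all_reps | ~~ good h0 c]|
       + #|[set c in all_reps | ~~ good z c]| + #|[set c in all_reps | fully_dominated [set z; h0] c]|.
      apply: leq_trans (leq_trans (leq_card_setU _ _) (leq_add (leq_trans (leq_card_setU _ _) (leq_add (leq_card_setU _ _) (leqnn _))) (leqnn _))).
      apply: subset_leq_card; apply/subsetP => c cQ; rewrite !in_setU ![c \in [set _ in _ | _]]inE cQ /=.
      by case: (good h0 c); case: (good z c); case: (fully_dominated _ c).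
    have arith n t x y v : n <= t + x + y + v -> x <= k.+1 -> y <= k.+1 -> v < 2 -> w <= n ->
      8 * k + 20 <= w -> 1 < t by clear; lia.
    exact: arith un b0 bz bd card_all_reps hw'.
  case/card_gt1P=> c [d [/TP[cQ zc] /TP[dQ zd] cd]].
  have [E|ne] := eqVneq (rho c) u; last by exists (rho c); [apply: imset_f|rewrite ne].
  exists (rho d); first exact: imset_f.
  rewrite zd andbT -E; apply: contraNneq cd => E'; apply/eqP; apply: Qs => //.
  have [h1 h2 _] := rhoP c (Qn c cQ); have [h3 h4 _] := rhoP d (Qn d dQ).
  apply: (@same_trans _ (rho c)) => //; try exact: Qn; first by rewrite same_sym.
  by rewrite -E'.
- move=> v hv vD; have [h1 h2] := clique_repP hv; have [h3 h4 _] := rhoP _ h1.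
  have rD : rho (clique_rep v) \in [set rho c | c in all_reps].
    by apply: imset_f; apply: clique_rep_in.
  exists (rho (clique_rep v)) => //; apply: (@same_adj _ _ (clique_rep v)) => //.
    by rewrite same_sym.
  by apply: contraNneq vD => ->.
- by move=> _ _ /imsetP[c cQ ->]; left; have [] := rhoP c (Qn c cQ).
Qed.

(** The number of cliques bounds the minimum from above. A set containing hubs misses fewer cliques
    than it has hubs, so it is larger. A hub-free set hits every clique, and the adjacent pair of a
    friendly triple spends two vertices on one clique. *)
Lemma no_trade_irreducible : 8 * k + 20 <= w -> no_trade (3 * k + 4) -> ~ reducible G.
Proof.
move=> hw' nt [D [sD minD] [x [y [z [xD yD zD xy _]]]]].
have [D0 sD0 cD0] := no_trade_sds hw' nt.
have cD := leq_trans (minD _ sD0) cD0; have [domD _] := sD; have [Qn Qs] := all_reps_reps.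
pose Hs := [set h in D | hub h].
pose F := [set c in all_reps | [forall d in D, ~~ (~~ hub d && same d c)]].
have hit c : c \in all_reps -> c \notin F -> exists2 d, d \in D & ~~ hub d && same d c.
  rewrite inE => -> /=; rewrite negb_forall_in => /existsP[d /andP[dD]].
  by rewrite negbK => h; exists d.
have domF c : c \in F -> fully_dominated Hs c.
  rewrite inE => /andP[cQ /forallP no]; apply/fully_dominatedP => v hv vc.
  have no' d : d \in D -> ~~ hub d -> ~~ same d c.
    by move=> dD hd; have := no d; rewrite dD hd.
  have vD : v \notin D by apply/negP => vD; have := no' v vD hv; rewrite vc.
  have [d dD vd] := domD v vD; exists d; last by rewrite sym.
  rewrite inE dD /=; apply: contraT => hd; have /negP := no' d dD hd; case.
  by apply: (@same_trans _ v) => //; [exact: Qn|rewrite /same sym vd orbT].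
have [H0|H0] := eqVneq Hs set0.
  have nh d : d \in D -> ~~ hub d.
    by move=> dD; apply/negP => hd; have := in_set0 d; rewrite -H0 inE dD hd.
  have F0 c : c \in all_reps -> c \notin F.
    move=> cQ; apply/negP => /domF /fully_dominatedP /(_ c (Qn c cQ)).
    by rewrite /same eqxx => /(_ isT)[h]; rewrite H0 inE.
  have : #|(D :\ x) :\: region all_reps| + #|all_reps| <= #|D :\ x|.
    apply: hit_card; first exact: all_reps_reps.
    move=> c cQ; have [d dD /andP[hd dc]] := hit c cQ (F0 c cQ).
    have [E|ne] := eqVneq d x; last by exists d; rewrite ?in_setD1 ?ne ?hd.
    exists y.
      by rewrite in_setD1 yD andbT; apply: contraTneq xy => ->; rewrite irr.
    have hx := nh x xD; have hy := nh y yD; rewrite hy /=.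
    apply: (@same_trans y x c) => //; [exact: Qn|by rewrite /same sym xy orbT|by rewrite -E].
  move: cD; rewrite (cardsD1 x D) xD => h1 h2.
  have arith a b c : 1 + a <= b -> c + b <= a -> False by clear; lia.
  exact: arith h1 h2.
have cF : #|F| < #|Hs|.
  apply: no_trade_all => //; first by move=> h; rewrite inE => /andP[].
  by split=> [c|c d]; rewrite !inE => /andP[h _]; [exact: Qn|case/andP=> h' _; apply: Qs].
have rQF : reps (all_reps :\: F).
  by split=> [c|c d]; rewrite !in_setD => /andP[_ h]; [exact: Qn|case/andP=> _ h'; apply: Qs].
have h1 : #|D :\: region (all_reps :\: F)| + #|all_reps :\: F| <= #|D|.
  by apply: hit_card => // c; rewrite in_setD => /andP[h1 h2]; apply: hit.
have h2 : #|Hs| <= #|D :\: region (all_reps :\: F)|.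
  apply: subset_leq_card; apply/subsetP => h; rewrite inE => /andP[hD hh].
  by rewrite in_setD hD inE hh.
have h3 := cardsID F all_reps.
have h4 : #|all_reps :&: F| <= #|F| by apply: subset_leq_card; apply: subsetIr.
have arith a b c d f g n : f < g -> a + b <= c -> g <= a -> d + b = n -> d <= f -> c <= n -> False by clear; lia.
exact: arith cF h1 h2 h3 h4 cD.
Qed.

End Hubs.

(** * Large induced matchings meeting a minimum set *)

Lemma exists_min (T : Type) (P : T -> Prop) (f : T -> nat) :
  (exists x, P x) -> exists x, P x /\ forall y, P y -> f x <= f y.
Proof.
case=> x Px; have [m le_m] := ubnP (f x); elim: m x Px le_m => // m IH x Px le_m.
case: (classic (exists y, P y /\ f y < f x)) => [[y [Py lt]]|no].
  by apply: (IH y Py); lia.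
exists x; split=> // y Py; rewrite leqNgt; apply/negP => lt; apply: no; by exists y.
Qed.

Lemma matching_of_set (G : sgraph) (I : finType) (J : {set I}) (F : I -> G * G) w :
  w <= #|J| -> {in J, forall i, adj G (F i).1 (F i).2} ->
  {in J &, forall i j, i <> j -> anti (F i) (F j)} ->
  exists M : 'I_w -> G * G, matching M /\ forall i, exists2 j, j \in J & M i = F j.
Proof.
move=> hw he ha; exists (fun i => F (enum_val (widen_ord hw i))); split; last first.
  by move=> i; exists (enum_val (widen_ord hw i)) => //; apply: enum_valP.
split=> [i|i j ij]; first by apply: he; apply: enum_valP.
apply: ha; try exact: enum_valP.
by move=> /enum_val_inj /(congr1 val) /= E; apply: ij; apply: val_inj.
Qed.

Section Transversal.
Variable G : sgraph.
Hypotheses (sym : symmetric (adj G)) (irr : irreflexive (adj G)).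

Definition independent_choice (J : {set G}) (x : G -> G) :=
  {in J, forall c, adj G c (x c)} /\ {in J &, forall c d, ~~ adj G (x c) (x d)}.

(* Two disjoint independent choices of maximum size dominate each other's neighbourhoods. *)
Lemma independent_choice_dichotomy t (Y : {set G}) :
  {in Y, forall c, exists v, adj G c v} -> t * t < #|Y| ->
  (exists (J : {set G}) x, [/\ J \subset Y, #|J| = t.+1 & independent_choice J x]) \/
  (exists (J1 J2 : {set G}) (x1 x2 : G -> G), [/\ J1 \subset Y, J2 \subset Y, [disjoint J1 & J2] & J1 != set0] /\
    [/\ {in J1, forall c, adj G c (x1 c)}, {in J2, forall c, adj G c (x2 c)},
      {in J1, forall c v, adj G c v -> exists2 d, d \in J2 & adj G v (x2 d)} &
      {in J2, forall c v, adj G c v -> exists2 d, d \in J1 & adj G v (x1 d)}]).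
Proof.
elim: t Y => [|t IH] Y nbr cY.
  have /card_gt0P[c cY'] : 0 < #|Y| by [].
  have [v cv] := nbr c cY'; left; exists [set c], (fun=> v); split.
  - by rewrite sub1set.
  - by rewrite cards1.
  - by split=> [_ /set1P->//|? ? _ _]; rewrite irr.
case: (classic (exists (J : {set G}) x, [/\ J \subset Y, #|J| = t.+2 & independent_choice J x])) => [|no2]; first by left.
right.
case: (classic (exists (J : {set G}) x, [/\ J \subset Y, #|J| = t.+1 & independent_choice J x])) => [[J1 [x1 [s1 c1 i1]]]|no1]; last first.
  have tY : t * t < #|Y| by apply: leq_trans cY; rewrite ltnS; apply: leq_mul.
  by have [/no1|] := IH Y nbr tY.
have subD : Y :\: J1 \subset Y by apply: subsetDl.
case: (classic (exists (J : {set G}) x, [/\ J \subset Y :\: J1, #|J| = t.+1 & independent_choice J x])) => [[J2 [x2 [s2 c2 i2]]]|no1]; last first.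
  (* Removing [t + 1] from more than [(t + 1) * (t + 1)] elements leaves more than [t * t]; this is
     the origin of the quadratic bound. *)
  have tY : t * t < #|Y :\: J1|.
    have := cardsID J1 Y; have /subset_leq_card := subsetIr Y J1; rewrite c1 => h1 h2.
    have arith a b y : a <= t.+1 -> a + b = y -> t.+1 * t.+1 < y -> t * t < b by clear; lia.
    exact: arith h1 h2 cY.
  have nbrD : {in Y :\: J1, forall c, exists v, adj G c v} by move=> c /(subsetP subD); apply: nbr.
  have [/no1//|[K1 [K2 [x [x' [[h1 h2 h3 h4] h5]]]]]] := IH _ nbrD tY.
  exists K1, K2, x, x'; split=> //; split=> //; [exact: subset_trans h1 subD|exact: subset_trans h2 subD].
have dis : [disjoint J1 & J2].
  rewrite disjoint_sym disjoints_subset; apply: subset_trans s2 _.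
  by apply/subsetP => c; rewrite !inE => /andP[].
have s2' := subset_trans s2 subD.
(* No choice has [t + 2] elements, so a neighbour [v] of a new vertex [c] must be adjacent to a
   chosen vertex: otherwise [c] with [v] would extend [J]. *)
have extend (J : {set G}) x c v : J \subset Y -> #|J| = t.+1 -> independent_choice J x -> c \in Y -> c \notin J ->
    adj G c v -> exists2 d, d \in J & adj G v (x d).
  move=> sJ cJ [iJ1 iJ2] cY' cJ' cv; apply: NNPP => no; apply: no2.
  exists (c |: J), (fun d => if d == c then v else x d); split.
  - by rewrite subUset sub1set cY'.
  - by rewrite cardsU1 cJ' cJ.
  - have nadj d : d \in J -> ~~ adj G v (x d).
      by move=> dJ; apply/negP => h; apply: no; exists d.
    have ne d : d \in J -> d == c = false by move=> dJ; apply/negbTE; apply: contraNneq cJ' => <-.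
    split=> [d|d d']; rewrite !in_setU1.
      by case/orP=> [/eqP->|dJ]; rewrite ?eqxx // ne //; apply: iJ1.
    case/orP=> [/eqP->|dJ] /orP[/eqP->|dJ']; rewrite ?eqxx ?ne ?irr //.
    + exact: nadj.
    + by rewrite sym; apply: nadj.
    + exact: iJ2.
have [i11 _] := i1; have [i21 _] := i2.
exists J1, J2, x1, x2; split; first by split=> //; rewrite -card_gt0 c1.
split=> // c cJ v cv.
- apply: (extend J2 x2 c) => //; first exact: (subsetP s1).
  by rewrite (disjointFr dis cJ).
- apply: (extend J1 x1 c) => //; first exact: (subsetP s2').
  by rewrite (disjointFl dis cJ).
Qed.

End Transversal.

(** * Covering the vertices far from a bounded core *)

Section Core.
Variables (G : sgraph) (A : {set G}).
Hypotheses (sym : symmetric (adj G)) (irr : irreflexive (adj G)).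
Hypothesis nbr : forall v, exists u, adj G v u.
Hypothesis core_nbr : {in A, forall a, exists2 a', a' \in A & adj G a a'}.

Definition outer := [set v | (v \notin A) && ~~ [exists a in A, adj G a v]].

Hypothesis outer_indep : {in outer &, forall u v, ~~ adj G u v}.

Lemma outerP v : v \notin outer -> v \notin A -> exists2 a, a \in A & adj G a v.
Proof.
by rewrite inE negb_and => /orP[/negbTE->//|/negPn/existsP[a /andP[aA av]] _]; exists a.
Qed.

Lemma outer_far v a : v \in outer -> a \in A -> ~~ adj G a v.
Proof.
rewrite inE => /andP[_ /existsPn/(_ a) h] aA; by move: h; rewrite aA.
Qed.

Lemma outer_nbr c v : c \in outer -> adj G c v -> v \notin outer /\ v \notin A.
Proof.
move=> cC cv; split; first by apply: contraTN cv => vC; apply: outer_indep.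
by apply: contraTN cv => vA; rewrite sym; apply: outer_far.
Qed.

(** Every vertex that is not outer has a neighbour in [A], the vertices of [A] included. So
    [A :|: S] dominates, and each of its vertices has a witness in [A]. *)
Lemma cover_bound (D S : {set G}) : min_sds D -> {in S, forall s, s \notin outer} ->
  {in outer, forall c, exists2 s, s \in S & adj G c s} -> #|D| <= #|A| + #|S|.
Proof.
move=> [_ minD] SC cov; apply: leq_trans (minD (A :|: S) _) (leq_card_setU _ _).
have toA v : v \notin outer -> exists2 a, a \in A & adj G v a.
  move=> vC; have [/core_nbr[a aA va]|vA] := boolP (v \in A); first by exists a.
  by have [a aA av] := outerP vC vA; exists a; rewrite // sym.
split=> [v|u]; rewrite in_setU.
  have [/cov[s sS vs] _|/toA[a aA va] _] := boolP (v \in outer).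
    by exists s; rewrite // in_setU sS orbT.
  by exists a; rewrite // in_setU aA.
move=> uAS; have uC : u \notin outer.
  by case/orP: uAS => [uA|/SC//]; rewrite inE uA.
have [a aA ua] := toA u uC; exists a; first by rewrite in_setU aA.
by rewrite /within2 ua andbT; apply: contraTneq ua => ->; rewrite irr.
Qed.

Lemma outer_cover (Y : {set G}) : Y \subset outer ->
  exists S : {set G}, [/\ {in S, forall s, s \notin outer},
     {in Y, forall c, exists2 s, s \in S & adj G c s} & #|S| <= #|Y|].
Proof.
move=> sY; pose b c := if [pick v | adj G c v] is Some v then v else c.
have bP c : adj G c (b c).
  by rewrite /b; case: pickP => [//|no]; have [u cu] := nbr c; have := no u; rewrite cu.
exists [set b c | c in Y]; split; last exact: leq_imset_card.
- by move=> _ /imsetP[c cY ->]; have [] := outer_nbr (subsetP sY c cY) (bP c).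
- by move=> c cY; exists (b c); [apply: imset_f|apply: bP].
Qed.

(** Two outer vertices with a common neighbour are covered by one vertex. Removing such pairs
    greedily either stops within [m] pairs, leaving disjoint neighbourhoods, or saves [m] covering
    vertices. *)
Lemma disjoint_nbhds_or_cover m (Y : {set G}) : Y \subset outer ->
  (exists Y1 : {set G}, [/\ Y1 \subset Y, #|Y| <= #|Y1| + 2 * m &
     {in Y1 &, forall c d, c != d -> forall x, adj G c x -> ~~ adj G d x}]) \/
  (exists S : {set G}, [/\ {in S, forall s, s \notin outer},
     {in Y, forall c, exists2 s, s \in S & adj G c s} & #|S| + m <= #|Y|]).
Proof.
elim: m Y => [|m IH] Y sY.
  by right; have [S [S1 S2 S3]] := outer_cover sY; exists S; rewrite addn0.
case: (classic (exists c d x, [/\ c \in Y, d \in Y, c != d, adj G c x & adj G d x])) => [|no]; last first.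
  left; exists Y; split=> //; first exact: leq_addr.
  by move=> c d cY dY cd x cx; apply/negP => dx; apply: no; exists c, d, x.
case=> c [d [x [cY dY cd cx dx]]].
pose Y' := (Y :\ c) :\ d.
have cY' : #|Y| = #|Y'| + 2.
  by rewrite (cardsD1 c Y) cY (cardsD1 d (Y :\ c)) in_setD1 eq_sym cd dY !add1n addn2.
have sY' : Y' \subset Y by apply: subset_trans (subsetDl _ _) (subsetDl _ _).
have [[Y1 [s1 c1 d1]]|[S [S1 S2 S3]]] := IH Y' (subset_trans sY' sY).
  left; exists Y1; split=> //; first exact: subset_trans s1 sY'.
  by rewrite cY'; move: c1; clear; lia.
right; exists (x |: S); split.
- move=> s; rewrite in_setU1 => /orP[/eqP->|/S1//].
  by have [] := outer_nbr (subsetP sY c cY) cx.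
- move=> e eY; have [eY'|] := boolP (e \in Y').
    by have [s sS es] := S2 e eY'; exists s; rewrite // in_setU1 sS orbT.
  rewrite !in_setD1 eY andbT negb_and !negbK => /orP[]/eqP->; by exists x; rewrite ?setU11.
- rewrite cY' cardsU1; case: (x \notin S) => /=; move: S3; clear; lia.
Qed.

(** The chosen neighbours replace [J1 :|: J2]: whatever the removed vertices dominated is dominated
    crosswise by the choices of the other set, and lost witnesses are replaced in the same way.
    Neighbours of outer vertices are not outer, so the outer part strictly shrinks. *)
Lemma swap_choice (D J1 J2 : {set G}) x1 x2 : semitotal_dom D ->
  [disjoint J1 & J2] -> J1 != set0 -> J1 \subset D :&: outer -> J2 \subset D :&: outer ->
  {in J1, forall c, adj G c (x1 c)} -> {in J2, forall c, adj G c (x2 c)} ->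
  {in J1, forall c v, adj G c v -> exists2 d, d \in J2 & adj G v (x2 d)} ->
  {in J2, forall c v, adj G c v -> exists2 d, d \in J1 & adj G v (x1 d)} ->
  exists D' : {set G}, [/\ semitotal_dom D', #|D'| <= #|D| & #|D' :&: outer| < #|D :&: outer|].
Proof.
move=> [dom sem] dis J0 s1 s2 a1 a2 d1 d2.
pose J := J1 :|: J2; pose X := [set x1 c | c in J1] :|: [set x2 c | c in J2].
have sJ : J \subset D :&: outer by rewrite subUset s1 s2.
have JD c : c \in J -> c \in D by move=> /(subsetP sJ); rewrite inE => /andP[].
have JC c : c \in J -> c \in outer by move=> /(subsetP sJ); rewrite [_ \in D :&: _]inE => /andP[].
have domJ c v : c \in J -> adj G c v -> exists2 x, x \in X & adj G v x.
  rewrite in_setU => /orP[cJ|cJ] cv.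
    by have [d dJ vd] := d1 c cJ v cv; exists (x2 d); rewrite // in_setU [_ \in [set x2 _ | _ in _]]imset_f ?orbT.
  by have [d dJ vd] := d2 c cJ v cv; exists (x1 d); rewrite // in_setU imset_f.
have XJ x : x \in X -> exists2 c, c \in J & adj G c x.
  rewrite in_setU => /orP[]/imsetP[c cJ ->]; exists c; rewrite ?in_setU ?cJ ?orbT //; [exact: a1|exact: a2].
have cX : #|X| <= #|J|.
  apply: leq_trans (leq_card_setU _ _) _; rewrite cardsU.
  move: dis; rewrite -setI_eq0 => /eqP ->; rewrite cards0 subn0.
  by apply: leq_add; apply: leq_imset_card.
exists ((D :\: J) :|: X); split; first split.
- move=> v; rewrite in_setU in_setD negb_or negb_and negbK => /andP[vJD vX].
  have [vJ|vJ] := boolP (v \in J).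
    have : exists2 x, x \in X & adj G v x.
      move: vJ; rewrite in_setU => /orP[vJ|vJ].
        by exists (x1 v); [rewrite in_setU imset_f|apply: a1].
      by exists (x2 v); [rewrite in_setU [_ \in [set x2 _ | _ in _]]imset_f ?orbT|apply: a2].
    by case=> x xX vx; exists x; rewrite // in_setU xX orbT.
  move: vJD; rewrite (negbTE vJ) /= => /dom[y yD vy].
  have [yJ|yJ] := boolP (y \in J); last by exists y; rewrite // in_setU in_setD yJ yD.
  have [x xX vx] := domJ y v yJ ltac:(by rewrite sym).
  by exists x; rewrite // in_setU xX orbT.
- move=> u uD'.
  have viaX v x : (v == u) || adj G u v -> x \in X -> adj G v x -> x != u ->
      exists2 t, t \in (D :\: J) :|: X & (t != u) && within2 u t.
    move=> uv xX vx xu; exists x; first by rewrite in_setU xX orbT.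
    rewrite xu /within2; case/orP: uv => [/eqP E|uv]; first by rewrite -E vx.
    by apply/orP; right; apply/existsP; exists v; rewrite uv.
  have neq_adj x : adj G u x -> x != u by move=> ux; apply: contraTneq ux => ->; rewrite irr.
  have [uX|uX] := boolP (u \in X).
    have [c cJ cu] := XJ u uX; have [x xX ux] := domJ c u cJ cu.
    by apply: (viaX u x) => //; rewrite ?eqxx // neq_adj.
  move: uD'; rewrite in_setU (negbTE uX) orbF in_setD => /andP[uJ uD].
  have [t tD /andP[tu ut]] := sem u uD.
  have [tJ|tJ] := boolP (t \in J); last by exists t; rewrite ?in_setU ?in_setD ?tJ ?tD ?tu.
  case/orP: ut => [ut|/existsP[v /andP[uv vt]]].
    have [x xX ux] := domJ t u tJ ltac:(by rewrite sym).
    by apply: (viaX u x) => //; rewrite ?eqxx // neq_adj.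
  have [x xX vx] := domJ t v tJ ltac:(by rewrite sym).
  by apply: (viaX v x) => //; [rewrite uv orbT|apply: contraNneq uX => <-].
- apply: leq_trans (leq_card_setU _ _) _; apply: leq_trans (leq_add (leqnn _) cX) _.
  rewrite -(cardsID J D) addnC leq_add2r; apply: subset_leq_card.
  by apply/subsetP => c cJ; rewrite inE cJ JD.
- apply: proper_card; apply/properP; split.
    apply/subsetP => v; rewrite in_setI in_setU in_setD => /andP[/orP[/andP[_ vD]|vX] vC].
      by rewrite in_setI vD.
    by have [c cJ cv] := XJ v vX; have [] := outer_nbr (JC c cJ) cv; rewrite vC.
  have /set0Pn[c cJ1] := J0; have cJ : c \in J by rewrite in_setU cJ1.
  exists c; first by rewrite in_setI JD // JC.
  rewrite in_setI in_setU in_setD cJ /= JC // andbT; apply/negP => cX'.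
  by have [d dJ dc] := XJ c cX'; have [] := outer_nbr (JC d dJ) dc; rewrite JC.
Qed.

Lemma large_matching (w b : nat) (D0 : {set G}) : #|A| <= b -> min_sds D0 ->
  b * (w + 3) + w * w + 4 * b + 4 < #|D0| -> ~ reducible G ->
  exists2 D : {set G}, min_sds D & exists2 M : 'I_w -> G * G, matching M & forall i, (M i).1 \in D.
Proof.
move=> cA minD0 big nred.
(* Among minimum sets, [D] has the fewest outer vertices, so that [swap_choice] yields a
   contradiction. *)
have [D [minD leastD]] : exists D, min_sds D /\ forall D', min_sds D' -> #|D :&: outer| <= #|D' :&: outer|.
  by apply: exists_min; exists D0.
have {}big : b * (w + 3) + w * w + 4 * b + 4 < #|D|.
  by apply: leq_trans big _; case: minD0 => _; apply; case: minD.
exists D => //; have [sD least] := minD; have [dom _] := sD.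
pose Y := D :&: outer; pose X := (D :\: outer) :\: A.
have sYC : Y \subset outer by apply: subsetIr.
have domX c : c \in outer -> c \notin Y -> exists2 x, x \in X & adj G c x.
  move=> cC; rewrite in_setI cC andbT => /dom[y yD cy]; exists y => //.
  by have [h1 h2] := outer_nbr cC cy; rewrite !in_setD h1 h2.
have cXY : #|X| + #|Y| <= #|D|.
  by rewrite -(cardsID outer D) addnC leq_add2l; apply: subset_leq_card; apply: subsetDl.
have XC x : x \in X -> [/\ x \in D, x \notin outer & x \notin A].
  by rewrite !in_setD => /and3P[].
have [small|large] := leqP #|Y| (w * w + 2 * b + 2); last first.
  (* Since [A] has at most [b] vertices, a cover that saves [b + 1] vertices contradicts
     [cover_bound]. *)
  have [[Y1 [s1 c1 d1]]|[S [S1 S2 S3]]] := disjoint_nbhds_or_cover b.+1 sYC; last first.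
    have : #|D| <= #|A| + #|S :|: X|.
      apply: cover_bound => // [s|c cC]; first by rewrite in_setU => /orP[/S1//|/XC[]].
      have [/S2[s sS cs]|/(domX c cC)[x xX cx]] := boolP (c \in Y).
        by exists s; rewrite // in_setU sS.
      by exists x; rewrite // in_setU xX orbT.
    move=> h1; have h2 := leq_card_setU S X.
    have arith d a u s x y : d <= a + u -> u <= s + x -> s + b.+1 <= y -> x + y <= d -> a <= b -> False by clear; lia.
    by case: (arith _ _ _ _ _ _ h1 h2 S3 cXY cA).
  have cY1 : w * w < #|Y1|.
    have arith y z : y <= z + 2 * b.+1 -> w * w + 2 * b + 2 < y -> w * w < z by clear; lia.
    exact: arith c1 large.
  have [[J [x [sJ cJ [x1 x2]]]]|] := independent_choice_dichotomy sym irr (fun c _ => nbr c) cY1.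
    have JY1 := subsetP sJ; have JY c : c \in J -> c \in Y by move=> /JY1; apply: (subsetP s1).
    have JC c : c \in J -> c \in outer by move=> /JY; apply: (subsetP sYC).
    have [|||M [hM hJ]] := @matching_of_set G G J (fun c => (c, x c)) w.
    - by rewrite cJ.
    - by move=> c cJ'; apply: x1.
    - move=> c d cJ' dJ /eqP cd; rewrite /anti /= x2 // outer_indep ?JC //= andbT.
      rewrite (d1 d c) ?JY1 ?x1 // 1?eq_sym //=.
      by rewrite sym (d1 c d) ?JY1 ?x1.
    by exists M => // i; have [j jJ ->] := hJ i; have := JY j jJ; rewrite in_setI => /andP[].
  case=> J1 [J2 [x1 [x2 [[t1 t2 dis J0] [a1 a2 e1 e2]]]]].
  have [D' [sD' cD' lt]] := swap_choice sD dis J0 (subset_trans t1 s1) (subset_trans t2 s1) a1 a2 e1 e2.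
  have /leastD : min_sds D' by split=> // E /least; apply: leq_trans.
  by rewrite leqNgt lt.
pose cover (S : {set G}) := (forall s, s \in S -> s \notin outer) /\
  (forall c, c \in outer -> exists2 s, s \in S & adj G c s).
have [S0 [S1 S2 S3]] : exists S : {set G}, [/\ {in S, forall s, s \notin outer},
    {in Y, forall c, exists2 s, s \in S & adj G c s} & #|S| <= #|Y|].
  exact: outer_cover.
(* A smallest cover inside [S0 :|: X] gives each of its vertices a private outer neighbour. As [S0]
   is small and [cover_bound] keeps the cover large, many of its vertices lie in [D]. *)
have [S [[sub [SC cov]] leastS]] : exists S : {set G}, (S \subset S0 :|: X /\ cover S) /\
    forall T : {set G}, (T \subset S0 :|: X /\ cover T) -> #|S| <= #|T|.
  apply: exists_min; exists (S0 :|: X); split=> //; split=> [s|c cC].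
    by rewrite in_setU => /orP[/S1//|/XC[]].
  have [/S2[s sS cs]|/(domX c cC)[x xX cx]] := boolP (c \in Y).
    by exists s; rewrite // in_setU sS.
  by exists x; rewrite // in_setU xX orbT.
have priv x : x \in S -> exists p, [/\ p \in outer, adj G x p & {in S, forall y, adj G y p -> y = x}].
  move=> xS; apply: NNPP => no.
  have : #|S| <= #|S :\ x|; last by rewrite (cardsD1 x S) xS add1n ltnn.
  apply: leastS; split; first by apply: subset_trans sub; apply: subsetDl.
  split=> [s|c cC]; first by rewrite in_setD1 => /andP[_ /SC].
  apply: NNPP => no'; apply: no; exists c.
  have only y : y \in S -> adj G y c -> y = x.
    move=> yS yc; apply/eqP; apply: contraT => yx; case: no'; exists y; last by rewrite sym.
    by rewrite in_setD1 yx yS.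
  by have [s sS cs] := cov c cC; split=> //; rewrite -(only s sS) // sym.
pose X' := X :&: S.
have cX' : b * (w + 2) < #|X'|.
  have h1 : #|D| <= #|A| + #|S| by apply: cover_bound.
  have h2 : #|S| <= #|S0| + #|X'|.
    apply: leq_trans (leq_card_setU _ _); apply: subset_leq_card; apply/subsetP => s sS.
    by rewrite in_setU in_setI sS andbT -in_setU; apply: (subsetP sub).
  have arith d a s s0 x y : d <= a + s -> s <= s0 + x -> a <= b -> s0 <= y -> y <= w * w + 2 * b + 2 ->
    b * (w + 3) + w * w + 4 * b + 4 < d -> b * (w + 2) < x by clear; lia.
  exact: arith h1 h2 cA S3 small big.
(* Every vertex of [X'] has a neighbour in [A], so pigeonhole applies. With at least [w + 3] common
   neighbours of [a] there are enough for [w] edges, and two adjacent ones would form a friendly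
   triple with a third. *)
have [a aA ca] : exists2 a, a \in A & w + 2 < #|[set x in X' | adj G a x]|.
  apply: NNPP => no.
  have bound a : a \in A -> #|[set x in X' | adj G a x]| <= w + 2.
    by move=> aA; rewrite leqNgt; apply/negP => h; apply: no; exists a.
  have : #|X'| <= #|A| * (w + 2).
    apply: (@leq_trans (\sum_(a in A) #|[set x in X' | adj G a x]|)); last first.
      by rewrite -sum_nat_const; apply: leq_sum.
    have -> : \sum_(a in A) #|[set x in X' | adj G a x]| = \sum_(x in X') \sum_(a in A) adj G a x.
      rewrite [RHS]exchange_big; apply: eq_bigr => a _.
      by rewrite -sum1dep_card big_mkcondr; apply: eq_bigr => x _ /=; case: (adj G a x).
    rewrite -sum1_card; apply: leq_sum => x; rewrite in_setI => /andP[/XC[_ xC xA] _].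
    by have [a aA ax] := outerP xC xA; rewrite (bigD1 a) //= ax.
  have h : #|A| * (w + 2) <= b * (w + 2) by rewrite leq_mul2r cA orbT.
  by move=> h'; have := leq_trans cX' (leq_trans h' h); rewrite ltnn.
pose T := [set x in X' | adj G a x]; rewrite -/T in ca.
have TP x : x \in T -> [/\ x \in D, x \in S & adj G a x].
  by rewrite inE in_setI => /andP[/andP[/XC[? _ _] ?] ?].
have indep : {in T &, forall x y, ~~ adj G x y}.
  move=> x y xT yT; apply/negP => xy; apply: nred; exists D => //.
  have [z [zT zx zy]] : exists z, [/\ z \in T, z != x & z != y].
    have : 0 < #|(T :\ x) :\ y|.
      have h1 := cardsD1 x T; have h2 := cardsD1 y (T :\ x).
      have arith (t u v : nat) (b1 b2 : bool) : w + 2 < t -> t = b1 + u -> u = b2 + v -> 0 < v.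
        by case: b1; case: b2 => /=; clear; lia.
      exact: arith ca h1 h2.
    by case/card_gt0P=> z; rewrite !in_setD1 => /and3P[? ? ?]; exists z.
  have [xD _ _] := TP x xT; have [yD _ ay] := TP y yT; have [zD _ az] := TP z zT.
  exists x, y, z; split=> //; split=> //; apply/orP; right; apply/existsP; exists a.
  by rewrite sym ay az.
pose pr x := if [pick p | [&& p \in outer, adj G x p & [forall y in S, adj G y p ==> (y == x)]]] is Some p then p else x.
have prP x : x \in T -> [/\ pr x \in outer, adj G x (pr x) & {in S, forall y, adj G y (pr x) -> y = x}].
  case/TP=> _ xS _; rewrite /pr; case: pickP => [p /and3P[h1 h2 h3]|].
    split=> // y yS yp; move/forallP/(_ y)/implyP/(_ yS)/implyP/(_ yp): h3; exact: eqP.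
  have [p [h1 h2 h3]] := priv x xS => /(_ p) /negP; case; rewrite h1 h2 /=.
  by apply/forallP => y; apply/implyP => yS; apply/implyP => yp; apply/eqP; apply: h3.
have wT : w <= #|T| by apply: leq_trans (ltnW ca); apply: leq_addr.
have [||M [hM hJ]] := @matching_of_set G G T (fun x => (x, pr x)) w wT.
- by move=> x /prP[].
- move=> x y xT yT xy; have [h1 h2 h3] := prP x xT; have [h4 h5 h6] := prP y yT.
  have [_ xS _] := TP x xT; have [_ yS _] := TP y yT.
  rewrite /anti /= indep // (outer_indep h1 h4) andbT /=; apply/andP; split.
    by apply/negP => h; apply: xy; apply: h6.
  by apply/negP; rewrite sym => h; apply: xy; rewrite (h3 y).
by exists M => // i; have [j jT ->] := hJ i; have [] := TP j jT.
Qed.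

End Core.

Lemma core_exists (G : sgraph) k : simple_graph G -> connected_graph G ->
  (exists x y, adj G x y) -> ~ p3_matching G k ->
  exists A : {set G}, [/\ #|A| <= 2 * k + 3, {in A, forall a, exists2 a', a' \in A & adj G a a'} &
    {in outer A &, forall u v, ~~ adj G u v}].
Proof.
move=> [sym irr] conn [x [y xy]]; elim: k => [|k IH] free.
  (* Without an induced path on three vertices the connected graph is complete, and any edge serves
     as [A]. *)
  exists [set x; y]; split; first by rewrite cards2; case: (x != y).
    move=> a; rewrite !inE => /orP[]/eqP->; [exists y|exists x]; rewrite ?set21 ?set22 //.
    by rewrite sym.
  have near v : connect (adj G) x v -> (v == x) || adj G x v.
    case/connectP=> p pth ->; elim/last_ind: p pth => [|p v' IH]; first by rewrite eqxx.
    rewrite rcons_path last_rcons => /andP[/IH h hl].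
    case/orP: h hl => [/eqP->->|h hl]; first by rewrite orbT.
    apply: contraT; rewrite negb_or => /andP[h1 h2]; case: free.
    exists x, (last x p), v', (fun=> (x, x)); split; last by case.
      by rewrite /p3 h hl h2 eq_sym.
    by split=> [[]|[]].
  move=> u v; rewrite inE => /andP[uA /existsPn/(_ x)]; rewrite set21 /=.
  move: uA; rewrite !inE negb_or => /andP[ux _].
  by have := near u (conn x u); rewrite (negbTE ux) /= => ->.
case: (classic (p3_matching G k)) => [|no]; last first.
  have [A [h1 h2 h3]] := IH no; exists A; split=> //; apply: leq_trans h1 _; clear; lia.
case=> a [b [c [M [/and4P[ab bc ac a_c] [Me Ma] Mf]]]].
pose A := [set a; b; c] :|: ([set (M i).1 | i in 'I_k] :|: [set (M i).2 | i in 'I_k]).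
have A1 i : (M i).1 \in A by rewrite !in_setU (imset_f (fun i => (M i).1)) // !orbT.
have A2 i : (M i).2 \in A by rewrite !in_setU (imset_f (fun i => (M i).2)) // !orbT.
have aA : a \in A by rewrite !inE eqxx.
have bA : b \in A by rewrite !inE eqxx ?orbT.
have cA : c \in A by rewrite !inE eqxx ?orbT.
exists A; split.
- have h1 : #|[set a; b; c]| <= 3.
    by apply: leq_trans (leq_card_setU _ _) _; rewrite cards1 cards2; case: (a != b).
  have h2 := leq_imset_card (fun i => (M i).1) 'I_k; have h3 := leq_imset_card (fun i => (M i).2) 'I_k.
  rewrite card_ord in h2 h3.
  apply: leq_trans (leq_card_setU _ _) _; apply: leq_trans (leq_add h1 (leq_card_setU _ _)) _.
  apply: leq_trans (leq_add (leqnn _) (leq_add h2 h3)) _; clear; lia.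
- move=> v; rewrite in_setU => /orP[|/setUP[]/imsetP[i _ ->]].
  + rewrite !inE => /orP[/orP[]|]/eqP->; [by exists b|by exists a; rewrite // sym|by exists b; rewrite // sym].
  + by exists (M i).2.
  + by exists (M i).1; rewrite // sym.
- move=> u v uC vC; apply/negP => uv.
  have fu z : z \in A -> ~~ adj G z u by exact: outer_far.
  have fv z : z \in A -> ~~ adj G z v by exact: outer_far.
  have gu z : z \in A -> ~~ adj G u z by move=> zA; rewrite sym fu.
  have gv z : z \in A -> ~~ adj G v z by move=> zA; rewrite sym fv.
  (* An edge between outer vertices joins the matching as index [None] and completes a forbidden
     subgraph with [k + 1] edges. *)
  pose M' (o : option 'I_k) := if o is Some i then M i else (u, v).
  have : #|[set: option 'I_k]| < k.+1; last by rewrite cardsT card_option card_ord ltnn.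
  apply: (p3_matching_bound free (a := a) (b := b) (c := c) (M := M')).
  + by rewrite /p3 ab bc ac.
  + by move=> [i|] _; [exact: Me|exact: uv].
  + move=> [i|] [j|] _ _ ij //=.
    * by apply: Ma => E; apply: ij; rewrite E.
    * by rewrite /anti /= !fu // !fv.
    * by rewrite /anti /= !gu // !gv.
  + by move=> [i|] _ /=; [exact: Mf|rewrite /far /= !fu // !fv].
Qed.

Lemma irreducible_large_matching k w : exists f, forall G : sgraph,
  simple_graph G -> connected_graph G -> (exists x y, adj G x y) -> ~ p3_matching G k ->
  ~ reducible G -> forall D0 : {set G}, min_sds D0 -> f < #|D0| ->
  exists2 D : {set G}, min_sds D & exists2 M : 'I_w -> G * G, matching M & forall i, (M i).1 \in D.
Proof.
pose b := 2 * k + 3; exists (b * (w + 3) + w * w + 4 * b + 4) => G simG conn edge free nred D0 minD0 big.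
have [A [cA hA hC]] := core_exists simG conn edge free; have [sym irr] := simG.
have nbr v : exists u, adj G v u.
  case: edge => x [y xy].
  have [E|ne] := eqVneq v x; first by exists y; rewrite E.
  have /connectP[[|u p] /=] := conn v x; first by move=> _ E; rewrite E eqxx in ne.
  by case/andP=> vu _ _; exists u.
exact: (large_matching sym irr nbr hA hC cA minD0 big nred).
Qed.

(** * The sentence *)

Definition fo_within2 (G : sgraph) (u v : G) :=
  adj G u v \/ exists z, adj G u z /\ adj G z v.

Definition tuple_sds (G : sgraph) s (t : 'I_s -> G) :=
  (forall x, (exists j, x = t j) \/ exists j, adj G x (t j)) /\
  (forall i, exists j, t j <> t i /\ fo_within2 (t i) (t j)).

Definition tuple_friendly (G : sgraph) s (t : 'I_s -> G) :=
  exists i j l, adj G (t i) (t j) /\ t l <> t i /\ t l <> t j /\ fo_within2 (t j) (t l).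

Definition fo_touch (G : sgraph) w (a b : 'I_w -> G) v i :=
  v = a i \/ v = b i \/ adj G v (a i) \/ adj G v (b i).

Definition fo_hub (G : sgraph) w (a b : 'I_w -> G) v :=
  exists i j : 'I_w, i != j /\ fo_touch a b v i /\ fo_touch a b v j.

Definition fo_matching (G : sgraph) w (a b : 'I_w -> G) :=
  (forall i, adj G (a i) (b i)) /\ (forall i j : 'I_w, i != j ->
    ~ adj G (a i) (a j) /\ ~ adj G (a i) (b j) /\ ~ adj G (b i) (a j) /\ ~ adj G (b i) (b j)).

Definition fo_trade (G : sgraph) w (a b : 'I_w -> G) r (hs cs : 'I_r.+1 -> G) :=
  (forall j, fo_hub a b (hs j)) /\ (forall j, ~ fo_hub a b (cs j)) /\
  (forall i j : 'I_r.+1, i != j -> ~ (cs i = cs j \/ adj G (cs i) (cs j))) /\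
  (forall i y, ~ fo_hub a b y -> (y = cs i \/ adj G y (cs i)) -> exists j, adj G (hs j) y).

(** Tuples may repeat vertices; that no shorter tuple works forces [s] to be gamma_t2. The edge in
    the second disjunct excludes the one-vertex graph, which has no semitotal dominating set and so
    would pass the remaining conditions. *)
Definition sentence (f w q : nat) (G : sgraph) :=
  (exists s : 'I_f.+1, (exists t : 'I_s -> G, tuple_sds t /\ tuple_friendly t) /\
     forall s' : 'I_s, ~ exists t : 'I_s' -> G, tuple_sds t) \/
  ((exists x y, adj G x y) /\ (forall s : 'I_f.+1, ~ exists t : 'I_s -> G, tuple_sds t) /\
   ~ exists a b : 'I_w -> G, fo_matching a b /\
      forall r : 'I_q, ~ exists hs cs : 'I_r.+1 -> G, fo_trade a b hs cs).

Lemma fo_const I (b : bool) : @fo I (fun _ _ => b).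
Proof.
move=> d v hv; exists (if b then FNot (FEq d d) else FEq d d) => G env rho hs _.
by case: b => /=; rewrite (onth_oob (s := env)) // hs.
Qed.

Lemma fo_within2_fo I (i j : I) : fo (fun G rho => fo_within2 (rho i) (rho j)).
Proof. by apply: fo_or; [exact: fo_adj|apply: fo_ex; apply: fo_and; exact: fo_adj]. Qed.

Lemma tuple_sds_fo I s (t : 'I_s -> I) : fo (fun G rho => tuple_sds (fun j => rho (t j))).
Proof.
apply: fo_and.
  apply: fo_all; apply: fo_or; apply: fo_exists_in => j; [exact: fo_eq|exact: fo_adj].
apply: fo_forall_in => i; apply: fo_exists_in => j; apply: fo_and; last exact: fo_within2_fo.
apply: fo_not; exact: fo_eq.
Qed.

Lemma tuple_friendly_fo I s (t : 'I_s -> I) : fo (fun G rho => tuple_friendly (fun j => rho (t j))).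
Proof.
apply: fo_exists_in => i; apply: fo_exists_in => j; apply: fo_exists_in => l.
apply: fo_and; first exact: fo_adj.
apply: fo_and; first by apply: fo_not; exact: fo_eq.
by apply: fo_and; [apply: fo_not; exact: fo_eq|exact: fo_within2_fo].
Qed.

Lemma fo_hub_fo I w (a b : 'I_w -> I) (v : I) :
  fo (fun G rho => fo_hub (fun j => rho (a j)) (fun j => rho (b j)) (rho v)).
Proof.
apply: fo_exists_in => i; apply: fo_exists_in => j; apply: fo_and; first exact: fo_const.
have touch l : fo (fun G rho => fo_touch (fun j => rho (a j)) (fun j => rho (b j)) (rho v) l).
  by apply: fo_or; [exact: fo_eq|apply: fo_or; [exact: fo_eq|apply: fo_or; exact: fo_adj]].
by apply: fo_and; apply: touch.
Qed.

Lemma fo_matching_fo I w (a b : 'I_w -> I) :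
  fo (fun G rho => fo_matching (fun j => rho (a j)) (fun j => rho (b j))).
Proof.
apply: fo_and; first by apply: fo_forall_in => i; exact: fo_adj.
apply: fo_forall_in => i; apply: fo_forall_in => j; apply: fo_imp; first exact: fo_const.
by do ?apply: fo_and; apply: fo_not; exact: fo_adj.
Qed.

Lemma fo_trade_fo I w (a b : 'I_w -> I) r (hs cs : 'I_r.+1 -> I) :
  fo (fun G rho => fo_trade (fun j => rho (a j)) (fun j => rho (b j))
                     (fun j => rho (hs j)) (fun j => rho (cs j))).
Proof.
apply: fo_and; first by apply: fo_forall_in => j; exact: fo_hub_fo.
apply: fo_and; first by apply: fo_forall_in => j; apply: fo_not; exact: fo_hub_fo.
apply: fo_and.
  apply: fo_forall_in => i; apply: fo_forall_in => j; apply: fo_imp; first exact: fo_const.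
  by apply: fo_not; apply: fo_or; [exact: fo_eq|exact: fo_adj].
apply: fo_forall_in => i; apply: fo_all; apply: fo_imp.
  apply: fo_not; exact: (fo_hub_fo (fun j => Some (a j)) (fun j => Some (b j)) None).
apply: fo_imp; first by apply: fo_or; [exact: fo_eq|exact: fo_adj].
by apply: fo_exists_in => j; exact: fo_adj.
Qed.

Lemma sentence_fo I f w q : @fo I (fun G _ => sentence f w q G).
Proof.
have sds J s : @fo J (fun G _ => exists t : 'I_s -> G, tuple_sds t).
  by apply: fo_exs; exact: (tuple_sds_fo (fun j => inr j)).
apply: fo_or.
  apply: fo_exists_in => s; apply: fo_and; last by apply: fo_forall_in => s'; apply: fo_not; exact: sds.
  apply: fo_exs; apply: fo_and; first exact: (tuple_sds_fo (fun j => inr j)).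
  exact: (tuple_friendly_fo (fun j => inr j)).
apply: fo_and; first by do 2!apply: fo_ex; exact: fo_adj.
apply: fo_and; first by apply: fo_forall_in => s; apply: fo_not; exact: sds.
apply: fo_not; apply: fo_exs; apply: fo_exs; apply: fo_and.
  exact: (fo_matching_fo (fun j => inl (inr j)) (fun j => inr j)).
apply: fo_forall_in => r; apply: fo_not; apply: fo_exs; apply: fo_exs.
exact: (fo_trade_fo (fun j => inl (inl (inl (inr j)))) (fun j => inl (inl (inr j)))
  (fun j => inl (inr j)) (fun j => inr j)).
Qed.

Lemma fo_within2P (G : sgraph) (u v : G) : fo_within2 u v <-> within2 u v.
Proof.
split=> [[h|[z [h1 h2]]]|/orP[h|/existsP[z /andP[h1 h2]]]].
- by rewrite /within2 h.
- by apply/orP; right; apply/existsP; exists z; rewrite h1.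
- by left.
- by right; exists z.
Qed.

Lemma tuple_sdsP (G : sgraph) s (t : 'I_s -> G) :
  tuple_sds t <-> semitotal_dom [set t j | j in 'I_s].
Proof.
split=> [[dom sem]|[dom sem]]; split.
- move=> x xt; have [[j E]|[j h]] := dom x; first by rewrite E imset_f in xt.
  by exists (t j) => //; apply: imset_f.
- move=> _ /imsetP[i _ ->]; have [j [/eqP h /fo_within2P h']] := sem i.
  by exists (t j); [apply: imset_f|rewrite h].
- move=> x; have [/imsetP[j _ ->]|/dom[_ /imsetP[j _ ->] h]] := boolP (x \in [set t j | j in 'I_s]).
    by left; exists j.
  by right; exists j.
- move=> i; have [_ /imsetP[j _ ->] /andP[/eqP h /fo_within2P h']] := sem (t i) (imset_f t (erefl _)).
  by exists j.
Qed.

Lemma tuple_friendlyP (G : sgraph) s (t : 'I_s -> G) :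
  tuple_friendly t <-> friendly [set t j | j in 'I_s].
Proof.
split=> [[i [j [l [h1 [/eqP h2 [/eqP h3 /fo_within2P h4]]]]]]|].
  by exists (t i), (t j), (t l); split=> //; apply: imset_f.
case=> _ [_ [_ [/imsetP[i _ ->] /imsetP[j _ ->] /imsetP[l _ ->] h1 [/eqP h2 /eqP h3 /fo_within2P h4]]]].
by exists i, j, l.
Qed.

Lemma tuple_of_set (G : sgraph) (D : {set G}) :
  exists t : 'I_#|D| -> G, [set t j | j in 'I_#|D|] = D.
Proof.
exists enum_val; apply/setP => x; apply/imsetP/idP => [[j _ ->]|xD]; first exact: enum_valP.
by exists (enum_rank_in xD x) => //; rewrite enum_rankK_in.
Qed.

Lemma fo_hubP (G : sgraph) w (a b : 'I_w -> G) v :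
  fo_hub a b v <-> hub (fun i => (a i, b i)) v.
Proof.
have touchP i : fo_touch a b v i <-> touch (fun i => (a i, b i)) v i.
  split=> [[->|[->|[h|h]]]|/or4P[/eqP->|/eqP->|h|h]]; rewrite /touch /= ?eqxx ?h ?orbT //.
  - by left.
  - by right; left.
  - by right; right; left.
  - by right; right; right.
split=> [[i [j [ij [/touchP h1 /touchP h2]]]]|/existsP[i /existsP[j /and3P[ij /touchP h1 /touchP h2]]]].
  by apply/existsP; exists i; apply/existsP; exists j; rewrite ij h1.
by exists i, j.
Qed.

Lemma fo_matchingP (G : sgraph) w (a b : 'I_w -> G) :
  fo_matching a b <-> matching (fun i => (a i, b i)).
Proof.
split=> -[he ha]; split=> // i j.
  by move=> /eqP /ha[/negP h1 [/negP h2 [/negP h3 /negP h4]]]; rewrite /anti /= h1 h2 h3 h4.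
by move=> /eqP /ha /and4P[/negP h1 /negP h2 /negP h3 /negP h4].
Qed.

Lemma no_tradeP (G : sgraph) w (a b : 'I_w -> G) q :
  (forall r : 'I_q, ~ exists hs cs : 'I_r.+1 -> G, fo_trade a b hs cs) <->
  no_trade (fun i => (a i, b i)) q.
Proof.
have nhubP v : ~ fo_hub a b v <-> ~~ hub (fun i => (a i, b i)) v.
  by split=> [h|/negP h /fo_hubP//]; apply/negP => /fo_hubP.
have sameP (u v : G) : (u = v \/ adj G u v) <-> same u v.
  by split=> [[->|h]|/orP[/eqP|]]; rewrite /same ?eqxx ?h ?orbT; auto.
split=> nt r [hs [cs [h1 [h2 [h3 h4]]]]]; apply: (nt r); exists hs, cs.
  split; [by move=> j; apply/fo_hubP|split; [by move=> j; apply/nhubP|split]].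
    by move=> i j /h3 /negP h /sameP.
  by move=> i y /nhubP hy /sameP yi; apply: h4 hy yi.
split; [by move=> j; apply/fo_hubP|split; [by move=> j; apply/nhubP|split]].
  by move=> i j /h3 h; apply/negP => /sameP.
by move=> i y /nhubP hy /sameP yi; apply: h4 hy yi.
Qed.

Lemma min_sds_exists (G : sgraph) : simple_graph G -> connected_graph G ->
  (exists x y, adj G x y) -> exists D : {set G}, min_sds D.
Proof.
move=> [sym irr] conn [x [y xy]].
have [D [sD minD]] : exists D : {set G}, semitotal_dom D /\ forall D' : {set G}, semitotal_dom D' -> #|D| <= #|D'|.
  apply: (@exists_min _ (@semitotal_dom G) (fun D : {set G} => #|D|)).
  exists [set: G]; split=> [v|v _]; first by rewrite inE.
  have [u vu] : exists u, adj G v u.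
    have [->|ne] := eqVneq v x; first by exists y.
    have /connectP[[|u p] /=] := conn v x; first by move=> _ E; rewrite E eqxx in ne.
    by case/andP=> vu _ _; exists u.
  exists u; first by rewrite inE.
  by rewrite /within2 vu andbT; apply: contraTneq vu => ->; rewrite irr.
by exists D.
Qed.

Lemma sentence_reducible k : exists f, forall G : sgraph,
  simple_graph G -> connected_graph G -> ~ p3_matching G k ->
  sentence f (8 * k + 20) (3 * k + 4) G <-> reducible G.
Proof.
pose w := 8 * k + 20.
have hw : k + 3 <= w by rewrite /w; lia.
have [f hf] := irreducible_large_matching k w.
exists f => G simG conn free; have [sym irr] := simG; split.
  case=> [[s [[t [/tuple_sdsP sd /tuple_friendlyP fr]] small]]|[edge [small nt]]].
    exists [set t j | j in 'I_s] => //; split=> // D' sD'.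
    rewrite leqNgt; apply/negP => lt.
    have lt' : #|D'| < s.
      by apply: leq_trans lt _; apply: leq_trans (leq_imset_card _ _) _; rewrite card_ord.
    have [t' Et] := tuple_of_set D'.
    by apply: (small (Ordinal lt')); exists t'; apply/tuple_sdsP; rewrite Et.
  apply: NNPP => nred; have [D0 minD0] := min_sds_exists simG conn edge.
  have big : f < #|D0|.
    rewrite ltnNge; apply/negP => le; have [t' Et] := tuple_of_set D0.
    have lt : #|D0| < f.+1 by [].
    by apply: (small (Ordinal lt)); exists t'; apply/tuple_sdsP; rewrite Et; case: minD0.
  have [D minD [M matM MD]] := hf G simG conn edge free nred D0 minD0 big.
  pose M' i := ((M i).1, (M i).2).
  have matM' : matching M' by [].
  apply: nt; exists (fun i => (M i).1), (fun i => (M i).2); split; first exact/fo_matchingP.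
  apply/no_tradeP; exact: (irreducible_no_trade sym irr free matM' hw (leqnn w) nred minD MD).
case=> D minD fr; have [sD least] := minD.
have [t Et] := tuple_of_set D; have [small|big] := leqP #|D| f.
  have lt : #|D| < f.+1 by [].
  left; exists (Ordinal lt); split.
    by exists t; split; [apply/tuple_sdsP; rewrite Et|apply/tuple_friendlyP; rewrite Et].
  move=> s' [t' /tuple_sdsP /least]; rewrite leqNgt; case/negP.
  by apply: leq_ltn_trans (leq_imset_card _ _) _; rewrite card_ord (ltn_ord s').
right; split; first by case: fr => x [y [z [_ _ _ xy _]]]; exists x, y.
split=> [s' [t' /tuple_sdsP /least]|[a [b [/fo_matchingP mat /no_tradeP nt]]]].
  rewrite leqNgt; case/negP; apply: leq_trans big; apply: leq_ltn_trans (leq_imset_card _ _) _.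
  by rewrite card_ord; apply: ltn_ord.
by apply: (no_trade_irreducible sym irr free mat hw conn (leqnn w) nt); exists D.
Qed.

Theorem theorem16 :
  forall k : nat,
  exists (p : seq instr) (c : nat),
  forall (n : nat) (e : rel 'I_n),
    simple_graph (graph_of n e) ->
    connected_graph (graph_of n e) ->
    P3kP2_free k (graph_of n e) ->
    exists m : nat -> nat,
      exec p (c * n.+1 ^ c) 0 (encode n e) = Some m /\
      (m 0 != 0 <-> ct_le1 (graph_of n e)).
Proof.
move=> k; have [f hf] := sentence_reducible k.
have [phi hphi] := @sentence_fo void f (8 * k + 20) (3 * k + 4) 0 (fun x => match x with end) (fun x => match x with end).
have [c hc] := program_correct phi; exists (program phi), c => n e simG conn free.
have [sym irr] := simG; have [m [hm m0]] := hc n e sym irr; exists m; split=> //; rewrite m0.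
have h1 := hphi (graph_of n e) [::] (fun x => match x with end) erefl (fun x => match x with end).
have h2 := hf (graph_of n e) simG conn (P3kP2_free_matching simG free).
split=> [/h1/h2/(reducible_ct_le1 simG)//|/(ct_le1_reducible simG)/h2/h1//].
Qed.
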